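(* The family of maps $l\mapsto l^{x_1,\ldots,x_m}$, $m\ge1$, $(x_1,\ldots,x_m)\in S^m$, generates the Borel σ-field on the space of loops. In particular, two loops whose multi-occupation fields $l^{x_1,\ldots,x_m}$ all coincide are equal.
   Context: $S$ is a countable set. A based loop is a right-continuous piecewise-constant path $l:[0,T]\to S$, $0<T<\infty$, with finitely many jumps and $l(T)=l(T-)=l(0)$, identified with a finite sequence $(\xi_1,\tau_1,\ldots,\xi_{p+1},\tau_{p+1})\in(S\times(0,\infty))^{p+1}$ of visited states and holding times; two based loops are equivalent if they have the same length and their periodic extensions differ by a time translation, and a loop is an equivalence class. The space of loops carries the Borel σ-field of its natural Polish (quotient) topology. Multi-occupation field: for $f:S^m\to\mathbb R$ and a based loop $l$ of length $t$, $\langle l,f\rangle=\sum_{j=0}^{m-1}\int_{0<s_1<\cdots<s_m<t}f\circ r_j(l(s_1),\ldots,l(s_m))\,ds_1\cdots ds_m$ with $r_j(z^1,\ldots,z^m)=(z^{1+j},\ldots,z^m,z^1,\ldots,z^j)$; $l^{x}=\langle l,\delta_x\rangle$ for $x\in S^m$, $\delta_x(y)=1_{\{x=y\}}$. *)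

(* Defs.v *)
From Stdlib Require Import Reals List ClassicalEpsilon.
Import ListNotations.
Open Scope R_scope.

Set Implicit Arguments.

Inductive sigma_gen {X : Type} (G : (X -> Prop) -> Prop) : (X -> Prop) -> Prop :=
| sg_base A : G A -> sigma_gen G A
| sg_full : sigma_gen G (fun _ => True)
| sg_compl A : sigma_gen G A -> sigma_gen G (fun x => ~ A x)
| sg_union (A : nat -> X -> Prop) :
    (forall n, sigma_gen G (A n)) -> sigma_gen G (fun x => exists n, A n x).

Definition open_R (B : R -> Prop) : Prop :=
  forall x, B x -> exists eps, 0 < eps /\ forall y, Rabs (y - x) < eps -> B y.
Definition Borel_R (B : R -> Prop) : Prop := sigma_gen open_R B.

Definition countable (St : Type) : Prop :=
  exists f : St -> nat, forall x y, f x = f y -> x = y.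

(** ** Based loops: sequences (xi_1,tau_1,...,xi_{p+1},tau_{p+1}) *)
Fixpoint consec_distinct {St : Type} (xs : list St) : Prop :=
  match xs with
  | x :: ((y :: _) as r) => x <> y /\ consec_distinct r
  | _ => True
  end.

(* p jumps (consecutive visited states distinct), positive holding times,
   and l(T-) = l(0), i.e. last visited state = first visited state. *)
Definition valid_seq {St : Type} (s : list (St * R)) : Prop :=
  match s with
  | nil => False
  | (x0, _) :: _ =>
      Forall (fun p => 0 < snd p) s /\
      consec_distinct (map fst s) /\
      last (map fst s) x0 = x0
  end.

Definition BL (St : Type) : Type := { s : list (St * R) | valid_seq s }.

Definition bl_states {St} (b : BL St) : list St := map fst (proj1_sig b).
Definition bl_times {St} (b : BL St) : list R := map snd (proj1_sig b).
Definition bl_len {St} (b : BL St) : R := fold_right Rplus 0 (bl_times b).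

Fixpoint path_aux {St} (s : list (St * R)) (dflt : St) (u : R) : St :=
  match s with
  | nil => dflt
  | (x, tau) :: r => if Rlt_dec u tau then x else path_aux r dflt (u - tau)
  end.

Definition bl_first {St} (b : BL St) : St :=
  match proj1_sig b as s return valid_seq s -> St with
  | nil => fun H => False_rect _ H
  | (x, _) :: _ => fun _ => x
  end (proj2_sig b).

(* the right-continuous path l : [0,T] -> S, with l(T) = l(0) *)
Definition bl_path {St} (b : BL St) (u : R) : St :=
  if Rlt_dec u 0 then bl_first b else path_aux (proj1_sig b) (bl_first b) u.

Definition bl_per {St} (b : BL St) (u : R) : St :=
  bl_path b (u - bl_len b * IZR (Int_part (u / bl_len b))).

Definition bl_equiv {St} (b b' : BL St) : Prop :=
  bl_len b = bl_len b' /\ exists c : R, forall u, bl_per b u = bl_per b' (u + c).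

(** Topology on based loops: S discrete, holding times with the usual topology *)
Definition open_BL {St} (U : BL St -> Prop) : Prop :=
  forall b, U b -> exists eps, 0 < eps /\
    forall b' : BL St, bl_states b' = bl_states b ->
      (forall i, (i < length (bl_times b))%nat ->
          Rabs (nth i (bl_times b') 0 - nth i (bl_times b) 0) < eps) ->
      U b'.

Definition Loop (St : Type) : Type :=
  { P : BL St -> Prop | exists b, P = bl_equiv b }.

Definition loop_of {St} (b : BL St) : Loop St :=
  exist _ (bl_equiv b) (ex_intro _ b eq_refl).

Definition loop_rep {St} (L : Loop St) : BL St :=
  proj1_sig (constructive_indefinite_description _ (proj2_sig L)).

Definition open_Loop {St} (V : Loop St -> Prop) : Prop :=
  open_BL (fun b => V (loop_of b)).

Definition Borel_Loop {St} (A : Loop St -> Prop) : Prop := sigma_gen open_Loop A.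

(* Riemann integral of f over [a,b] (0 if f is not Riemann integrable) *)
Definition Rint (f : R -> R) (a b : R) : R :=
  match excluded_middle_informative
          (exists I, exists pr : Riemann_integrable f a b, RiemannInt pr = I) with
  | left H => proj1_sig (constructive_indefinite_description _ H)
  | right _ => 0
  end.

(* simplex_int l k g u = int_{0<s_1<...<s_k<u} g(l(s_1),...,l(s_k)) ds *)
Fixpoint simplex_int {St} (l : R -> St) (k : nat) (g : list St -> R) (u : R) : R :=
  match k with
  | O => g nil
  | Datatypes.S k' => Rint (fun s => simplex_int l k' (fun z => g (z ++ [l s])) s) 0 u
  end.

Definition rot_j {St} (j : nat) (z : list St) : list St := skipn j z ++ firstn j z.

Definition occ_based {St} (m : nat) (f : list St -> R) (b : BL St) : R :=
  fold_right Rplus 0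
    (map (fun j => simplex_int (bl_path b) m (fun z => f (rot_j j z)) (bl_len b))
         (seq 0 m)).

Definition delta {St} (x : list St) (y : list St) : R :=
  if excluded_middle_informative (y = x) then 1 else 0.

(* l^{x_1,...,x_m} = <l, delta_x> on loops (through any representative) *)
Definition loop_occ {St} (x : list St) (L : Loop St) : R :=
  occ_based (length x) (delta x) (loop_rep L).

Definition occ_generators {St} (A : Loop St -> Prop) : Prop :=
  exists x : list St, (1 <= length x)%nat /\
    exists B : R -> Prop, Borel_R B /\ A = (fun L => B (loop_occ x L)).

(* Main.v *)
Require Import Defs.
From Stdlib Require Import Reals List.
From Stdlib Require Import Factorial Lra Lia ClassicalEpsilon.
From Stdlib Require Import FunctionalExtensionality PropExtensionality ProofIrrelevance.
From Coquelicot Require Import Coquelicot.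
Import List ListNotations.
Open Scope R_scope.

(** The iterated integrals of a path along words are the coefficients of Chen's series, a product
of exponentials over the pieces of the path; the occupation field of a word is the sum of the
coefficients over its rotations, and is therefore unchanged when the loop is rotated. Let a loop
visit cyclically w_1, ..., w_p with holding times t_1, ..., t_p. The fields of cyclically reduced
words vanish beyond length p, so p is measurable. On a word v_1^{n_1+1} ... v_p^{n_p+1} with p blocks
the field is, up to an explicit factor, the sum over the rotations of the loop taking w to v of the
monomials t_1^{n_1+1} ... t_p^{n_p+1}. Hence sum (prod t_i) P(t) over these rotations is measurable
for every polynomial P, and large powers P^N with P = 4 K - |t - q|^2 detect whether the orbit of
the holding times meets a small ball around q. Rational centers and radii give a countable base of
measurable sets, which also separates loops. Conversely the fields are continuous. *)

(** * Finite sums and rotations of lists *)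

(** A field is a sum over rotations, so single holding times cannot be read off from it. What can be
    read off are the moments of a finite measure: the sum, over the rotations of the loop that spell
    v, of point masses at the rotated holding times t, with weight prod t_i. The weight is forced,
    since blocks are non-empty and every exponent is at least 1. Words with p blocks are chosen
    because then each piece must fill exactly one block; for p >= 2, a rotation that cuts a block
    inside produces p + 1 blocks and contributes 0. With fewer blocks, pieces may share a block or
    be left out, and the field mixes many terms. Because the weights are positive, no moment theorem
    or polynomial approximation is needed: the sums of P^N grow like the N-th power of the largest
    value of P on the orbit, provided that P is nonnegative there. The constant 4 K ensures this, as
    |t - q|^2 <= 2 |t|^2 + 2 |q|^2 and |t| is constant on the orbit. Chen's series turns rotation
    invariance into a trace property of a product. *)

Fixpoint nsum (f : nat -> R) (n : nat) : R :=
  match n with O => 0 | S n' => nsum f n' + f n' end.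

Lemma nsum_ext f g n :
  (forall i, (i < n)%nat -> f i = g i) -> nsum f n = nsum g n.
Proof. induction n as [|n IH]; simpl; intros H; auto. rewrite IH, H; auto. Qed.

Lemma nsum_zero n : nsum (fun _ => 0) n = 0.
Proof. induction n as [|n IH]; simpl; lra. Qed.

Lemma nsum_const k n : nsum (fun _ => k) n = INR n * k.
Proof. induction n as [|n IH]; [simpl; ring|]. rewrite S_INR. simpl. rewrite IH. ring. Qed.

Lemma nsum_le f g n :
  (forall i, (i < n)%nat -> f i <= g i) -> nsum f n <= nsum g n.
Proof.
  induction n as [|n IH]; simpl; intros H; [lra|].
  apply Rplus_le_compat; auto.
Qed.

Lemma nsum_plus f g n : nsum (fun i => f i + g i) n = nsum f n + nsum g n.
Proof. induction n as [|n IH]; simpl; [|rewrite IH]; lra. Qed.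

Lemma nsum_scal k f n : nsum (fun i => k * f i) n = k * nsum f n.
Proof. induction n as [|n IH]; simpl; [|rewrite IH]; lra. Qed.

Lemma nsum_swap (f : nat -> nat -> R) n m :
  nsum (fun i => nsum (f i) m) n = nsum (fun j => nsum (fun i => f i j) n) m.
Proof.
  induction n as [|n IH]; simpl.
  - now rewrite nsum_zero.
  - now rewrite IH, nsum_plus.
Qed.

Lemma nsum_add f a b : nsum f (a + b) = nsum f a + nsum (fun i => f (a + i)%nat) b.
Proof.
  induction b as [|b IH]; [rewrite Nat.add_0_r|rewrite Nat.add_succ_r]; simpl; [|rewrite IH]; lra.
Qed.

Lemma nsum_Sl f n : nsum f (S n) = f O + nsum (fun i => f (S i)) n.
Proof. change (S n) with (1 + n)%nat. rewrite nsum_add. simpl. lra. Qed.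

Lemma nsum_rev f n : nsum (fun i => f (n - i)%nat) (S n) = nsum f (S n).
Proof.
  induction n as [|n IH]; [reflexivity|].
  rewrite nsum_Sl. change (nsum f (S (S n))) with (nsum f (S n) + f (S n)).
  rewrite <- IH, Rplus_comm. reflexivity.
Qed.

Lemma nsum_term_le f n i :
  (forall j, 0 <= f j) -> (i < n)%nat -> f i <= nsum f n.
Proof.
  intros H. induction n as [|n IH]; intros Hi; [lia|]. simpl.
  assert (0 <= nsum f n).
  { rewrite <- (nsum_zero n). apply nsum_le; auto. }
  destruct (Nat.eq_dec i n) as [->|]; [lra|].
  specialize (IH ltac:(lia)). specialize (H n). lra.
Qed.

(** The sum over i + m indices is split once after i terms and once after m terms. *)
Lemma nsum_periodic_shift h m i :
  (forall j, h (j + m)%nat = h j) -> nsum (fun j => h (i + j)%nat) m = nsum h m.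
Proof.
  intros H. assert (E := nsum_add h i m).
  rewrite Nat.add_comm, nsum_add in E.
  rewrite (nsum_ext (fun j => h (m + j)%nat) h) in E; [lra|].
  intros j _. now rewrite Nat.add_comm.
Qed.

(** On the left the indices run over m, ..., 1; the hypothesis exchanges the end m for 0. *)
Lemma nsum_periodic_rev h m :
  h m = h O -> nsum (fun j => h (m - j)%nat) m = nsum h m.
Proof.
  intros H. assert (E := nsum_rev h m). simpl in E.
  rewrite Nat.sub_diag in E. lra.
Qed.

Lemma fold_right_seq f m : fold_right Rplus 0 (map f (seq 0 m)) = nsum f m.
Proof.
  revert f. induction m as [|m IH]; intros f; [reflexivity|].
  rewrite nsum_Sl, <- cons_seq, <- seq_shift. simpl. now rewrite map_map, IH.
Qed.

Definition rot1 {A} (x : list A) : list A :=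
  match x with nil => nil | a :: y => y ++ [a] end.

Definition rotn {A} (j : nat) (x : list A) : list A := Nat.iter j rot1 x.

Lemma rotn_add {A} i j (x : list A) : rotn (i + j) x = rotn i (rotn j x).
Proof. apply Nat.iter_add. Qed.

Lemma rotn_S {A} j (x : list A) : rotn (S j) x = rotn j (rot1 x).
Proof. unfold rotn. now rewrite Nat.iter_succ_r. Qed.

Lemma length_rotn {A} j (x : list A) : length (rotn j x) = length x.
Proof.
  revert x. induction j as [|j IH]; intros x; [reflexivity|].
  rewrite rotn_S, IH. destruct x; simpl; [reflexivity|]. rewrite length_app. simpl; lia.
Qed.

Lemma map_rotn {A B} (f : A -> B) j x : map f (rotn j x) = rotn j (map f x).
Proof.
  revert x. induction j as [|j IH]; intros x; [reflexivity|].
  rewrite !rotn_S, IH. f_equal. destruct x; simpl; [reflexivity|]. now rewrite map_app.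
Qed.

Lemma rotn_app {A} (a b : list A) : rotn (length a) (a ++ b) = b ++ a.
Proof.
  revert b. induction a as [|c a IH]; intros b; [now rewrite app_nil_r|].
  simpl length. rewrite rotn_S. simpl. rewrite <- app_assoc, IH, <- app_assoc. reflexivity.
Qed.

Lemma rotn_full {A} (x : list A) : rotn (length x) x = x.
Proof. rewrite <- (app_nil_r x) at 2. now rewrite rotn_app. Qed.

Lemma rotn_periodic {A} j (x : list A) : rotn (j + length x) x = rotn j x.
Proof. now rewrite rotn_add, rotn_full. Qed.

Lemma rotn_split {A} j (x : list A) :
  (j <= length x)%nat -> rotn j x = skipn j x ++ firstn j x.
Proof.
  intros H. rewrite <- (rotn_app (firstn j x) (skipn j x)), firstn_skipn.
  now rewrite firstn_length_le.
Qed.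

Lemma rotn_eq_iff {A} j (x z : list A) :
  (j <= length x)%nat -> length z = length x ->
  (rotn j z = x <-> z = rotn (length x - j) x).
Proof.
  intros Hj Hz. split.
  - intros <-. rewrite length_rotn, <- rotn_add.
    replace (length z - j + j)%nat with (length z) by lia. now rewrite rotn_full.
  - intros ->. rewrite <- rotn_add.
    replace (j + (length x - j))%nat with (length x) by lia. now rewrite rotn_full.
Qed.

Lemma Forall_rotn {A} (P : A -> Prop) j x : Forall P x -> Forall P (rotn j x).
Proof.
  revert x. induction j as [|j IH]; intros x H; [exact H|].
  rewrite rotn_S. apply IH. destruct H; simpl; [constructor|].
  apply Forall_app; auto.
Qed.

Definition eqi {A} (a b : A) : R := if excluded_middle_informative (a = b) then 1 else 0.

Lemma eqi_refl {A} (a : A) : eqi a a = 1.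
Proof. unfold eqi. destruct excluded_middle_informative; tauto. Qed.

Lemma eqi_neq {A} (a b : A) : a <> b -> eqi a b = 0.
Proof. unfold eqi. destruct excluded_middle_informative; tauto. Qed.

(** * Convolution of functions on words *)

(** Functions on words are read as noncommutative formal power series, and this is their product:
    [f] takes a prefix and [g] the remaining suffix. The recursion moves the first letter into
    [f]. *)
Fixpoint conv {A} (f g : list A -> R) (x : list A) : R :=
  f nil * g x +
  match x with nil => 0 | a :: y => conv (fun z => f (a :: z)) g y end.

(** Behaves like a trace for [conv]. A rotation of a periodic word is counted as often as it
    occurs. *)
Definition cyc {A} (f : list A -> R) (x : list A) : R :=
  nsum (fun j => f (rotn j x)) (length x).

Definition one_word {A} (x : list A) : R := match x with nil => 1 | _ => 0 end.

Lemma conv_nsum {A} (f g : list A -> R) x :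
  conv f g x = nsum (fun i => f (firstn i x) * g (skipn i x)) (S (length x)).
Proof.
  revert f. induction x as [|a x IH]; intros f; [simpl; lra|].
  rewrite nsum_Sl. simpl. now rewrite IH.
Qed.

Lemma conv_linear_l {A} k (f f' g : list A -> R) x :
  conv (fun y => k * f y + f' y) g x = k * conv f g x + conv f' g x.
Proof.
  rewrite !conv_nsum, <- nsum_scal, <- nsum_plus. apply nsum_ext. intros; ring.
Qed.

Lemma conv_zero_l {A} (f g : list A -> R) x : (forall y, f y = 0) -> conv f g x = 0.
Proof.
  intros H. rewrite conv_nsum. rewrite <- (nsum_zero (S (length x))).
  apply nsum_ext. intros; rewrite H; ring.
Qed.

Lemma conv_scal_r {A} k (f g : list A -> R) x :
  conv f (fun y => k * g y) x = k * conv f g x.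
Proof.
  rewrite !conv_nsum, <- nsum_scal. apply nsum_ext. intros; ring.
Qed.

Lemma conv_assoc {A} (f g h : list A -> R) x :
  conv (conv f g) h x = conv f (conv g h) x.
Proof.
  revert f g. induction x as [|a x IH]; intros f g; [simpl; ring|].
  change (conv (conv f g) h (a :: x)) with
    (conv f g nil * h (a :: x) +
     conv (fun y => f nil * g (a :: y) + conv (fun z => f (a :: z)) g y) h x).
  rewrite conv_linear_l, IH. simpl. ring.
Qed.

Lemma conv_one_l {A} (g : list A -> R) : conv one_word g = g.
Proof.
  apply functional_extensionality. intros [|a x]; simpl; [ring|].
  rewrite conv_zero_l; [ring|reflexivity].
Qed.

Lemma conv_one_r {A} (f : list A -> R) : conv f one_word = f.
Proof.
  apply functional_extensionality. intros x. revert f.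
  induction x as [|a x IH]; intros f; simpl; [|rewrite IH]; ring.
Qed.

Lemma conv_snoc {A} (f g : list A -> R) y a :
  conv f g (y ++ [a]) = conv f (fun z => g (z ++ [a])) y + f (y ++ [a]) * g nil.
Proof.
  revert f. induction y as [|b y IH]; intros f; simpl; [ring|].
  rewrite IH. ring.
Qed.

(** A cut of a cyclic word into two arcs can be read starting from either arc. Exchanging the arcs
    is a rotation, which the sum over all rotations absorbs. *)
Lemma cyc_conv {A} (f g : list A -> R) x : cyc (conv f g) x = cyc (conv g f) x.
Proof.
  unfold cyc. set (m := length x).
  transitivity (nsum (fun j => nsum (fun i =>
    f (firstn i (rotn j x)) * g (skipn i (rotn j x))) (S m)) m).
  { apply nsum_ext. intros j _. now rewrite conv_nsum, length_rotn. }
  transitivity (nsum (fun j => nsum (fun i =>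
    g (firstn i (rotn j x)) * f (skipn i (rotn j x))) (S m)) m).
  2:{ apply nsum_ext. intros j _. now rewrite conv_nsum, length_rotn. }
  rewrite !(nsum_swap _ m (S m)), <- (nsum_rev _ m).
  apply nsum_ext. intros i Hi.
  (* After rotation by m - i the suffix of length i comes first, so cutting at i restores the two
     arcs of the cut at m - i, in the other order. *)
  rewrite <- (nsum_periodic_shift (fun j => g (firstn i (rotn j x)) * f (skipn i (rotn j x))) m (m - i)).
  2:{ intros j. unfold m. now rewrite rotn_periodic. }
  apply nsum_ext. intros j _. rewrite rotn_add.
  assert (L : length (rotn j x) = m) by apply length_rotn.
  rewrite (rotn_split (m - i)) by lia.
  assert (L1 : length (skipn (m - i) (rotn j x)) = i) by (rewrite length_skipn; lia).
  set (p := skipn (m - i) (rotn j x)) in *. set (q := firstn (m - i) (rotn j x)).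
  rewrite firstn_app, skipn_app, L1, Nat.sub_diag, (firstn_all2 p), (skipn_all2 p) by lia.
  simpl. rewrite app_nil_r. ring.
Qed.

(** * Iterated integrals along a piecewise constant path *)

Fixpoint const_word {A} (a : A) (y : list A) : R :=
  match y with nil => 1 | b :: z => eqi a b * const_word a z end.

(* The coefficients of exp(t a) in noncommutative formal power series. *)
Definition expw {A} (a : A) (t : R) (y : list A) : R :=
  const_word a y * (t ^ length y / INR (fact (length y))).

(* Chen's series of the path with holding times [s]: the product of the exponentials. *)
Fixpoint wint {A} (s : list (A * R)) : list A -> R :=
  match s with
  | nil => one_word
  | (a, t) :: r => conv (expw a t) (wint r)
  end.

Definition total {A} (s : list (A * R)) : R := fold_right Rplus 0 (map snd s).

Definition nonneg_times {A} (s : list (A * R)) : Prop := Forall (fun p => 0 <= snd p) s.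

Lemma total_app {A} (s1 s2 : list (A * R)) : total (s1 ++ s2) = total s1 + total s2.
Proof. induction s1 as [|p s1 IH]; unfold total in *; simpl; [|rewrite IH]; lra. Qed.

Lemma total_cons {A} (a : A) t s : total ((a, t) :: s) = t + total s.
Proof. reflexivity. Qed.

Lemma total_nonneg {A} (s : list (A * R)) : nonneg_times s -> 0 <= total s.
Proof.
  induction 1 as [|[a t] s H _ IH]; [unfold total; simpl; lra|].
  rewrite total_cons. simpl in H. lra.
Qed.

Lemma wint_app {A} (s1 s2 : list (A * R)) : wint (s1 ++ s2) = conv (wint s1) (wint s2).
Proof.
  induction s1 as [|[a t] s1 IH]; simpl; [now rewrite conv_one_l|].
  rewrite IH. apply functional_extensionality; intros x. now rewrite conv_assoc.
Qed.

Lemma wint_single {A} (a : A) t : wint [(a, t)] = expw a t.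
Proof. apply conv_one_r. Qed.

Lemma expw_0 {A} (a : A) : expw a 0 = one_word.
Proof.
  apply functional_extensionality. intros [|b y]; unfold expw; simpl; [field|].
  unfold Rdiv. ring.
Qed.

Lemma const_word_snoc {A} (a b : A) y : const_word a (y ++ [b]) = eqi a b * const_word a y.
Proof. induction y as [|c y IH]; simpl; [|rewrite IH]; ring. Qed.

Lemma is_derive_expw {A} (a b : A) v y :
  is_derive (fun t => expw a t (y ++ [b])) v (eqi a b * expw a v y).
Proof.
  unfold expw. rewrite const_word_snoc, length_app, Nat.add_1_r.
  set (n := length y). rewrite fact_simpl, mult_INR.
  assert (INR (S n) <> 0) by (apply not_0_INR; lia).
  assert (INR (fact n) <> 0) by apply INR_fact_neq_0.
  auto_derive; [exact I|].
  change (Nat.pred (S n)) with n. field. split; assumption.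
Qed.

Lemma is_derive_conv_r {A} (f : list A -> R) (g : R -> list A -> R) g' v y :
  (forall z, is_derive (fun t => g t z) v (g' z)) ->
  is_derive (fun t => conv f (g t) y) v (conv f g' y).
Proof.
  intros H. revert f. induction y as [|a y IH]; intros f; simpl.
  - apply (is_derive_ext (fun t => f nil * g t nil)); [intros; simpl; ring|].
    rewrite Rplus_0_r. apply is_derive_scal, H.
  - apply @is_derive_plus; [apply is_derive_scal, H|apply IH].
Qed.

(** Chen's differential equation: lengthening the last piece removes the last letter of the word.
    The last letter is the right one to remove because the outermost variable of [simplex_int] is
    the latest time. *)
Lemma is_derive_wint_snoc {A} (s : list (A * R)) (b : A) y a v :
  is_derive (fun t => wint (s ++ [(b, t)]) (y ++ [a])) v
    (eqi b a * wint (s ++ [(b, v)]) y).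
Proof.
  apply (is_derive_ext (fun t =>
    conv (wint s) (fun z => expw b t (z ++ [a])) y + wint s (y ++ [a]) * 1)).
  { intros t. rewrite wint_app, wint_single, conv_snoc. unfold expw at 3. simpl. field. }
  rewrite wint_app, wint_single, <- conv_scal_r.
  rewrite <- (Rplus_0_r (conv _ _ _)).
  apply @is_derive_plus; [|apply @is_derive_const].
  apply is_derive_conv_r. intros z. apply is_derive_expw.
Qed.

Lemma continuous_wint_snoc {A} (s : list (A * R)) (b : A) y v :
  continuous (fun t => wint (s ++ [(b, t)]) y) v.
Proof.
  induction y as [|a y _] using rev_ind.
  - apply (continuous_ext (fun _ => wint s nil)); [|apply continuous_const].
    intros t. rewrite wint_app, wint_single. unfold expw. simpl. field.
  - apply @ex_derive_continuous. eexists. apply is_derive_wint_snoc.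
Qed.

Lemma path_app {A} (s1 s2 : list (A * R)) d u :
  nonneg_times s1 -> 0 <= u ->
  path_aux (s1 ++ s2) d u =
  if Rlt_dec u (total s1) then path_aux s1 d u else path_aux s2 d (u - total s1).
Proof.
  intros H. revert u. induction H as [|[a t] s1 Ht Hs IH]; intros u Hu.
  - unfold total; simpl. destruct Rlt_dec as [L|L]; [lra|]. now rewrite Rminus_0_r.
  - rewrite total_cons. simpl in Ht |- *. assert (0 <= total s1) by now apply total_nonneg.
    destruct (Rlt_dec u t).
    + destruct Rlt_dec; [reflexivity|lra].
    + rewrite IH by lra. destruct Rlt_dec; destruct Rlt_dec; try lra; [reflexivity|].
      f_equal. ring.
Qed.

Lemma is_RInt_Rint f a b I : is_RInt f a b I -> Rint f a b = I.
Proof.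
  intros H. unfold Rint. destruct excluded_middle_informative as [E|E].
  - destruct constructive_indefinite_description as [J [pr <-]]. simpl.
    rewrite <- RInt_Reals. now apply is_RInt_unique.
  - exfalso. apply E. assert (pr : Riemann_integrable f a b).
    { apply ex_RInt_Reals_0. now exists I. }
    now exists (RiemannInt pr), pr.
Qed.

Lemma simplex_int_ext {A} (l : R -> A) k f g u :
  (forall z, length z = k -> f z = g z) -> simplex_int l k f u = simplex_int l k g u.
Proof.
  revert f g u. induction k as [|k IH]; intros f g u H; simpl; [now apply H|].
  f_equal. apply functional_extensionality. intros s. apply IH.
  intros z Hz. apply H. rewrite length_app. simpl. lia.
Qed.

Lemma simplex_int_zero {A} (l : R -> A) k u : simplex_int l k (fun _ => 0) u = 0.
Proof.
  revert u. induction k as [|k IH]; intros u; simpl; [reflexivity|].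
  apply is_RInt_Rint. apply (is_RInt_ext (fun _ => 0)); [intros; now rewrite IH|].
  replace 0 with (scal (u - 0) 0) at 2 by (unfold scal; simpl; unfold mult; simpl; ring).
  apply @is_RInt_const.
Qed.

Lemma simplex_int_snoc {A} (l : R -> A) y a u :
  simplex_int l (length (y ++ [a])) (delta (y ++ [a])) u =
  Rint (fun s => eqi (l s) a * simplex_int l (length y) (delta y) s) 0 u.
Proof.
  rewrite length_app, Nat.add_1_r. simpl. f_equal. apply functional_extensionality. intros s.
  unfold eqi. destruct excluded_middle_informative as [E|E].
  - rewrite Rmult_1_l. f_equal. apply functional_extensionality. intros z.
    unfold delta. rewrite E.
    destruct excluded_middle_informative as [E1|E1]; destruct excluded_middle_informative as [E2|E2]; auto.
    + apply app_inj_tail in E1. tauto.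
    + now subst.
  - rewrite Rmult_0_l, <- (simplex_int_zero l (length y) s).
    f_equal. apply functional_extensionality. intros z. unfold delta.
    destruct excluded_middle_informative as [E1|E1]; auto.
    apply app_inj_tail in E1. tauto.
Qed.

(** Induction on the word from its last letter and, inside it, on the path from its last piece. On
    that piece the integrand is the derivative given by [is_derive_wint_snoc], so the fundamental
    theorem of calculus applies. *)
Lemma simplex_int_wint {A} (d : A) y s l :
  nonneg_times s -> (forall u, 0 <= u < total s -> l u = path_aux s d u) ->
  simplex_int l (length y) (delta y) (total s) = wint s y.
Proof.
  revert s. induction y as [|a y IHy] using rev_ind; intros s Hs Hl.
  - simpl. unfold delta. destruct excluded_middle_informative; [|tauto].
    clear. induction s as [|[b t] s IH]; simpl; [reflexivity|].
    rewrite <- IH. unfold expw. simpl. field.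
  - rewrite simplex_int_snoc. apply is_RInt_Rint.
    induction s as [|[b t] s IHs] using rev_ind.
    { replace (wint nil (y ++ [a])) with (@zero R_NormedModule) by (destruct y; reflexivity).
      apply @is_RInt_point. }
    apply Forall_app in Hs. destruct Hs as [Hs Ht]. apply Forall_inv in Ht. simpl in Ht.
    rewrite total_app, total_cons in *. unfold total at 2 in Hl. unfold total at 2.
    simpl in Hl |- *. rewrite Rplus_0_r in *.
    assert (H0 := total_nonneg s Hs).
    replace (wint (s ++ [(b, t)]) (y ++ [a])) with
      (plus (wint s (y ++ [a])) (minus (wint (s ++ [(b, t)]) (y ++ [a])) (wint s (y ++ [a]))))
      by (unfold plus, minus, opp; simpl; unfold plus; simpl; ring).
    apply @is_RInt_Chasles with (total s).
    + apply IHs; [exact Hs|]. intros u Hu. rewrite Hl by lra.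
      rewrite path_app by (tauto || lra). destruct Rlt_dec; [reflexivity|lra].
    (* The coefficient of the path stopped at time v; at v = [total s] the last piece has length 0
       and disappears. *)
    + set (F v := wint (s ++ [(b, v - total s)]) (y ++ [a])).
      replace (wint (s ++ [(b, t)]) (y ++ [a])) with (F (total s + t))
        by (unfold F; do 4 f_equal; ring).
      replace (wint s (y ++ [a])) with (F (total s))
        by (unfold F; rewrite wint_app, wint_single, Rminus_diag, expw_0, conv_one_r; reflexivity).
      apply (is_RInt_ext (fun v => eqi b a * wint (s ++ [(b, v - total s)]) y)).
      { intros v Hv. rewrite Rmin_left, Rmax_right in Hv by lra.
        assert (Hp : forall u, 0 <= u < v -> l u = path_aux (s ++ [(b, v - total s)]) d u).
        { intros u Hu. rewrite Hl by lra. rewrite !path_app by (tauto || lra).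
          destruct Rlt_dec; [reflexivity|]. simpl.
          repeat (destruct Rlt_dec; try lra). reflexivity. }
        (* The shorter word is used along the path stopped at v, for the same function [l]; this is
           why [l] is only required to follow the path on the half-open interval. *)
        rewrite <- (IHy (s ++ [(b, v - total s)])).
        - rewrite total_app. unfold total at 2. simpl.
          replace (total s + (v - total s + 0)) with v by ring. f_equal. f_equal.
          rewrite Hl by lra. rewrite path_app by (tauto || lra).
          destruct Rlt_dec; [lra|]. simpl. destruct Rlt_dec; [reflexivity|lra].
        - apply Forall_app. split; [exact Hs|]. constructor; [simpl; lra|constructor].
        - intros u Hu. apply Hp. rewrite total_app in Hu. unfold total at 2 in Hu.
          simpl in Hu. lra. }
      apply (is_RInt_derive F).
      * intros v _. unfold F.
        replace (eqi b a * wint (s ++ [(b, v - total s)]) y)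
          with (scal 1 (eqi b a * wint (s ++ [(b, v - total s)]) y))
          by (unfold scal; simpl; unfold mult; simpl; ring).
        apply (is_derive_comp (fun r => wint (s ++ [(b, r)]) (y ++ [a])) (fun v => v - total s)).
        -- apply is_derive_wint_snoc.
        -- auto_derive; [exact I|ring].
      * intros v _. apply @continuous_scal_r with (k := eqi b a).
        apply (continuous_comp (fun v => v - total s) (fun r => wint (s ++ [(b, r)]) y)).
        -- apply @ex_derive_continuous. auto_derive. exact I.
        -- apply continuous_wint_snoc.
Qed.

(* [wint] is an integral over the path, so it does not see how the path was cut into pieces. *)
Lemma wint_path_ext {A} (d : A) s s' :
  nonneg_times s -> nonneg_times s' -> total s = total s' ->
  (forall u, 0 <= u < total s -> path_aux s d u = path_aux s' d u) ->
  wint s = wint s'.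
Proof.
  intros Hs Hs' HT Hp. apply functional_extensionality. intros y.
  rewrite <- (simplex_int_wint d y s (path_aux s d)) by auto.
  rewrite HT. apply (simplex_int_wint d); auto.
  intros u Hu. apply Hp. lra.
Qed.

Lemma delta_rot_j {A} (x z : list A) j :
  (j <= length x)%nat -> length z = length x ->
  delta x (rot_j j z) = delta (rotn (length x - j) x) z.
Proof.
  intros Hj Hz. unfold delta, rot_j. rewrite <- rotn_split by lia.
  assert (E := rotn_eq_iff j x z Hj Hz).
  destruct excluded_middle_informative; destruct excluded_middle_informative; tauto.
Qed.

Lemma bl_len_total {A} (b : BL A) : bl_len b = total (proj1_sig b).
Proof. reflexivity. Qed.

Lemma bl_nonneg_times {A} (b : BL A) : nonneg_times (proj1_sig b).
Proof.
  destruct b as [[|[a t] s] H]; [destruct H|]. simpl in *. destruct H as [H _].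
  eapply Forall_impl; [|exact H]. simpl. intros; lra.
Qed.

Lemma occ_based_cyc {A} (x : list A) (b : BL A) :
  occ_based (length x) (delta x) b = cyc (wint (proj1_sig b)) x.
Proof.
  unfold occ_based, cyc. rewrite fold_right_seq.
  (* Rotating the arguments by j amounts to rotating the word by m - j, so the sum is run
     backwards. *)
  rewrite <- (nsum_periodic_rev (fun j => wint (proj1_sig b) (rotn j x))) by now rewrite rotn_full.
  apply nsum_ext. intros j Hj.
  rewrite (simplex_int_ext _ _ _ (delta (rotn (length x - j) x)))
    by (intros; apply delta_rot_j; lia).
  rewrite <- (length_rotn (length x - j) x) at 1.
  apply (simplex_int_wint (bl_first b)); [apply bl_nonneg_times|].
  intros u Hu. unfold bl_path. destruct Rlt_dec; [lra|reflexivity].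
Qed.

(** * Periodic extensions and translations *)

(** The residue of u modulo T, written exactly as in [bl_per]. *)
Definition frac (T u : R) : R := u - T * IZR (Int_part (u / T)).

Lemma frac_bounds T u : 0 < T -> 0 <= frac T u < T.
Proof.
  intros HT. unfold frac. destruct (base_Int_part (u / T)) as [H1 H2].
  set (k := IZR (Int_part (u / T))) in *.
  assert (E : u = T * (u / T)) by (field; lra). set (v := u / T) in *. rewrite E. split; nra.
Qed.

Lemma frac_eq T u v k : 0 <= v < T -> u = v + T * IZR k -> frac T u = v.
Proof.
  intros Hv Hu. assert (HT : 0 < T) by lra.
  assert (B := frac_bounds T u HT). unfold frac in *.
  set (j := Int_part (u / T)) in *. subst u.
  assert (Hk : -1 < IZR k - IZR j < 1) by (split; nra).
  rewrite <- minus_IZR in Hk. destruct Hk as [Hk1 Hk2].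
  apply lt_IZR in Hk1, Hk2. assert (E : k = j) by lia. rewrite E. ring.
Qed.

Lemma frac_small T u : 0 <= u < T -> frac T u = u.
Proof. intros H. apply frac_eq with 0%Z; [exact H|ring]. Qed.

Lemma frac_frac_add T u c : 0 < T -> frac T (frac T u + c) = frac T (u + c).
Proof.
  intros HT. apply frac_eq with (Int_part ((u + c) / T) - Int_part (u / T))%Z.
  - now apply frac_bounds.
  - rewrite minus_IZR. unfold frac. ring.
Qed.

Definition per {A} (s : list (A * R)) (d : A) (u : R) : A := path_aux s d (frac (total s) u).

(** The relation of [bl_equiv] on arbitrary lists, so that it also applies to cut paths and to
    cyclic lists, which are not valid sequences. *)
Definition peq {A} (s s' : list (A * R)) : Prop :=
  total s = total s' /\ exists c, forall d u, per s d u = per s' d (u + c).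

Lemma path_default {A} (s : list (A * R)) d d' u :
  s <> nil -> u < total s -> path_aux s d u = path_aux s d' u.
Proof.
  revert u. induction s as [|[a t] s IH]; intros u Hs H; [congruence|].
  rewrite total_cons in H. simpl. destruct Rlt_dec; [reflexivity|].
  apply IH; [|lra]. intros ->. unfold total in H. simpl in H. lra.
Qed.

Lemma per_default {A} (s : list (A * R)) d d' u : 0 < total s -> per s d u = per s d' u.
Proof.
  intros H. apply path_default; [|now apply frac_bounds].
  intros ->. unfold total in H; simpl in H; lra.
Qed.

Lemma peq_sym {A} (s s' : list (A * R)) : peq s s' -> peq s' s.
Proof.
  intros [HT [c H]]. split; [auto|]. exists (- c). intros d u.
  rewrite H. f_equal. ring.
Qed.

Lemma peq_trans {A} (s1 s2 s3 : list (A * R)) : peq s1 s2 -> peq s2 s3 -> peq s1 s3.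
Proof.
  intros [HT [c H]] [HT' [c' H']]. split; [congruence|].
  exists (c + c'). intros d u. rewrite H, H'. f_equal. ring.
Qed.

Lemma peq_path {A} (s s' : list (A * R)) :
  0 < total s -> total s = total s' ->
  (forall d u, 0 <= u < total s -> path_aux s d u = path_aux s' d u) -> peq s s'.
Proof.
  intros H0 HT H. split; [exact HT|]. exists 0. intros d u. unfold per.
  rewrite Rplus_0_r, <- HT. apply H. now apply frac_bounds.
Qed.

Lemma per_rotate {A} (s1 s2 : list (A * R)) d u :
  nonneg_times s1 -> nonneg_times s2 -> 0 < total (s1 ++ s2) ->
  per (s2 ++ s1) d u = per (s1 ++ s2) d (u + total s1).
Proof.
  intros H1 H2 HT. unfold per. rewrite !total_app in *. rewrite (Rplus_comm (total s2)).
  set (T := total s1 + total s2) in *. assert (HT1 := total_nonneg _ H1).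
  assert (HT2 := total_nonneg _ H2).
  rewrite <- (frac_frac_add T u) by exact HT.
  assert (B := frac_bounds T u HT). set (v := frac T u) in *. clearbody v. clear u.
  rewrite path_app by (tauto || lra). destruct Rlt_dec as [L|L].
  - rewrite frac_small by (unfold T in *; lra). rewrite path_app by (tauto || lra).
    destruct Rlt_dec; [lra|]. f_equal. ring.
  - rewrite (frac_eq T (v + total s1) (v - total s2) 1) by (unfold T in *; lra).
    rewrite path_app by (tauto || (unfold T in *; lra)).
    destruct Rlt_dec; [reflexivity|unfold T in *; lra].
Qed.

Lemma peq_app_comm {A} (s1 s2 : list (A * R)) :
  nonneg_times s1 -> nonneg_times s2 -> 0 < total (s1 ++ s2) -> peq (s2 ++ s1) (s1 ++ s2).
Proof.
  intros. split; [rewrite !total_app; ring|].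
  exists (total s1). intros d u. now apply per_rotate.
Qed.

Lemma peq_merge {A} (a : A) t t' s :
  0 < t -> 0 < t' -> nonneg_times s -> peq ((a, t) :: (a, t') :: s) ((a, t + t') :: s).
Proof.
  intros Ht Ht' Hs. assert (H0 := total_nonneg s Hs).
  apply peq_path; rewrite ?total_cons; [lra|lra|].
  intros d u Hu. simpl.
  repeat (destruct Rlt_dec; try lra); try reflexivity. f_equal. ring.
Qed.

(** A piece may be cut at one of its ends, leaving a part of length 0; hence [nonneg_times] instead
    of positive times. *)
Lemma cut_path {A} (s : list (A * R)) c :
  nonneg_times s -> 0 <= c <= total s ->
  exists s1 s2, nonneg_times s1 /\ nonneg_times s2 /\ total s1 = c /\
    total (s1 ++ s2) = total s /\
    forall d u, 0 <= u < total s -> path_aux s d u = path_aux (s1 ++ s2) d u.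
Proof.
  intros Hs. revert c. induction Hs as [|[a t] s Ht Hs IH]; intros c Hc.
  - exists nil, nil. unfold total in *. simpl in *.
    repeat split; try constructor; auto; lra.
  - rewrite total_cons in *. simpl in Ht. destruct (Rlt_dec c t) as [L|L].
    + exists [(a, c)], ((a, t - c) :: s). unfold nonneg_times.
      split; [constructor; [simpl; lra|constructor]|].
      split; [constructor; [simpl; lra|exact Hs]|].
      split; [unfold total; simpl; ring|].
      split; [simpl app; rewrite !total_cons; ring|].
      intros d u Hu. simpl.
      repeat (destruct Rlt_dec; try lra); try reflexivity. f_equal. ring.
    + destruct (IH (c - t)) as [s1 [s2 [H1 [H2 [H3 [H4 H5]]]]]]; [lra|].
      exists ((a, t) :: s1), s2. split; [constructor; auto|]. split; [exact H2|].
      split; [rewrite total_cons; lra|].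
      split; [simpl app; rewrite total_cons; lra|].
      intros d u Hu. simpl. destruct Rlt_dec; [reflexivity|]. apply H5. lra.
Qed.

(** If the second path is cut at the translation time into s1 s2, the first one runs through s2 s1.
    Both series are then products of the same two factors in opposite orders, and [cyc_conv]
    applies. *)
Lemma cyc_wint_peq {A} (s s' : list (A * R)) x :
  nonneg_times s -> nonneg_times s' -> 0 < total s -> peq s s' ->
  cyc (wint s) x = cyc (wint s') x.
Proof.
  intros Hs Hs' H0 [HT [c Hc]].
  assert (B := frac_bounds (total s) c H0).
  destruct (cut_path s' (frac (total s) c)) as [s1 [s2 [H1 [H2 [H3 [H4 H5]]]]]];
    [exact Hs'|lra|].
  (* Only a default state [d] is wanted from the first piece. *)
  destruct s as [|[d t] s0] eqn:Es; [unfold total in H0; simpl in H0; lra|].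
  rewrite <- Es in *. clear Es s0 t.
  assert (E' : wint s' = wint (s1 ++ s2)).
  { apply (wint_path_ext d); auto. now apply Forall_app. }
  assert (E : wint s = wint (s2 ++ s1)).
  { apply (wint_path_ext d); auto; [now apply Forall_app| |].
    - rewrite total_app in *. lra.
    - intros u Hu.
      transitivity (per s d u); [unfold per; now rewrite frac_small|].
      transitivity (per (s2 ++ s1) d u).
      2:{ unfold per. rewrite frac_small; [reflexivity|]. rewrite total_app in *. lra. }
      rewrite Hc, per_rotate, H3 by (auto; lra). unfold per. rewrite H4, <- HT.
      rewrite H5 by (rewrite <- HT; now apply frac_bounds). f_equal.
      rewrite (Rplus_comm u (frac _ _)), frac_frac_add by exact H0. f_equal. ring. }
  rewrite E, E', !wint_app. apply cyc_conv.
Qed.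

Lemma bl_total_pos {A} (b : BL A) : 0 < total (proj1_sig b).
Proof.
  assert (N := bl_nonneg_times b).
  destruct b as [[|[a t] s] H]; [destruct H|]. simpl in *. destruct H as [H _].
  apply Forall_inv in H. apply Forall_inv_tail in N. apply total_nonneg in N.
  simpl in H. rewrite total_cons. lra.
Qed.

Lemma bl_per_per {A} (b : BL A) d u : bl_per b u = per (proj1_sig b) d u.
Proof.
  assert (H := bl_total_pos b). assert (B := frac_bounds _ u H).
  rewrite (per_default _ d (bl_first b)) by exact H.
  unfold bl_per, bl_path, per. rewrite bl_len_total.
  change (u - _) with (frac (total (proj1_sig b)) u).
  destruct Rlt_dec; [lra|reflexivity].
Qed.

Lemma bl_equiv_peq {A} (b b' : BL A) : bl_equiv b b' <-> peq (proj1_sig b) (proj1_sig b').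
Proof.
  unfold bl_equiv, peq. rewrite !bl_len_total.
  split; intros [HT [c H]]; (split; [exact HT|]); exists c.
  - intros d u. now rewrite <- !bl_per_per.
  - intros u. rewrite !(bl_per_per _ (bl_first b)). apply H.
Qed.

Lemma peq_refl {A} (s : list (A * R)) : peq s s.
Proof. split; [reflexivity|]. exists 0. intros. f_equal. ring. Qed.

Lemma loop_of_eq {A} (b b' : BL A) :
  loop_of b = loop_of b' <-> peq (proj1_sig b) (proj1_sig b').
Proof.
  rewrite <- bl_equiv_peq. unfold loop_of. split; intros H.
  - apply (f_equal (@proj1_sig _ _)) in H. simpl in H.
    rewrite H. apply bl_equiv_peq, peq_refl.
  - assert (E : bl_equiv b = bl_equiv b').
    { apply functional_extensionality. intros b0. apply propositional_extensionality.
      rewrite !bl_equiv_peq. apply bl_equiv_peq in H.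
      split; intros; eapply peq_trans; eauto using peq_sym. }
    apply subset_eq_compat. exact E.
Qed.

Lemma loop_of_rep {A} (L : Loop A) : loop_of (loop_rep L) = L.
Proof.
  unfold loop_rep. destruct constructive_indefinite_description as [b Hb]. simpl.
  destruct L as [P HP]. simpl in *. apply subset_eq_compat. now symmetry.
Qed.

Lemma loop_occ_loop_of {A} (x : list A) (b : BL A) :
  loop_occ x (loop_of b) = cyc (wint (proj1_sig b)) x.
Proof.
  unfold loop_occ. rewrite occ_based_cyc.
  apply cyc_wint_peq; try apply bl_nonneg_times; [apply bl_total_pos|].
  apply loop_of_eq, loop_of_rep.
Qed.

(** * Cyclic representation of loops *)

Definition cyc_distinct {A} (w : list A) : Prop :=
  match w with
  | a :: _ :: _ => consec_distinct (w ++ [a])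
  | _ => True
  end.

Definition valid_cyc {A} (c : list (A * R)) : Prop :=
  c <> nil /\ Forall (fun p => 0 < snd p) c /\ cyc_distinct (map fst c).

(* A based loop must not start at a jump, hence the first holding time is cut in two. *)
Definition unroll {A} (c : list (A * R)) : list (A * R) :=
  match c with
  | (a, t) :: ((_ :: _) as r) => (a, t / 2) :: r ++ [(a, t / 2)]
  | _ => c
  end.

Lemma consec_distinct_app {A} (l1 l2 : list A) a :
  consec_distinct (l1 ++ a :: l2) <-> consec_distinct (l1 ++ [a]) /\ consec_distinct (a :: l2).
Proof.
  induction l1 as [|b l1 IH]; [simpl; tauto|].
  destruct l1 as [|c l1]; simpl in *; tauto.
Qed.

Lemma cyc_distinct_rot1 {A} (w : list A) : cyc_distinct w -> cyc_distinct (rot1 w).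
Proof.
  destruct w as [|a [|b w]]; try (simpl; tauto). intros H.
  change (rot1 (a :: b :: w)) with (b :: (w ++ [a])).
  unfold cyc_distinct in *. destruct (w ++ [a]) as [|e l] eqn:E; [destruct w; discriminate|].
  rewrite <- E. clear E e l. simpl app in *. rewrite <- app_assoc. simpl app.
  change (b :: w ++ [a; b]) with ((b :: w) ++ a :: [b]). apply consec_distinct_app.
  destruct H as [H1 H2]. split; [exact H2|]. simpl. auto.
Qed.

Lemma cyc_distinct_rotn {A} j (w : list A) : cyc_distinct w -> cyc_distinct (rotn j w).
Proof.
  revert w. induction j as [|j IH]; intros w H; [exact H|].
  rewrite rotn_S. now apply IH, cyc_distinct_rot1.
Qed.

Lemma cyc_distinct_consec {A} (w : list A) : cyc_distinct w -> consec_distinct w.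
Proof.
  destruct w as [|a [|b w]]; [simpl; auto..|]. unfold cyc_distinct. intros H.
  destruct (exists_last (l := a :: b :: w) ltac:(discriminate)) as [l [e E]].
  rewrite E in *. rewrite <- app_assoc in H. now apply consec_distinct_app in H.
Qed.

Lemma valid_cyc_rotn {A} j (c : list (A * R)) : valid_cyc c -> valid_cyc (rotn j c).
Proof.
  intros [H1 [H2 H3]]. split; [|split].
  - intros E. apply H1, length_zero_iff_nil. rewrite <- (length_rotn j), E. reflexivity.
  - now apply Forall_rotn.
  - rewrite map_rotn. now apply cyc_distinct_rotn.
Qed.

Lemma valid_cyc_nonneg {A} (c : list (A * R)) : valid_cyc c -> nonneg_times c.
Proof.
  intros [_ [H _]]. eapply Forall_impl; [|exact H]. simpl. intros; lra.
Qed.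

Lemma valid_cyc_total {A} (c : list (A * R)) : valid_cyc c -> 0 < total c.
Proof.
  intros H. assert (N := valid_cyc_nonneg c H). destruct H as [H1 [H2 _]].
  destruct H2 as [|[a t] c Ht _]; [congruence|]. apply Forall_inv_tail in N.
  apply total_nonneg in N. rewrite total_cons. simpl in Ht. lra.
Qed.

Lemma unroll_valid {A} (c : list (A * R)) : valid_cyc c -> valid_seq (unroll c).
Proof.
  intros [H1 [H2 H3]]. destruct c as [|[a t] [|[b u] c]]; [congruence|simpl; auto|].
  unfold unroll, valid_seq. split; [|split].
  - inversion H2; subst. simpl in *. constructor; [simpl; lra|].
    apply Forall_app with (l1 := (b, u) :: c). split; auto. constructor; [simpl; lra|constructor].
  - rewrite map_cons, map_app. exact H3.
  - rewrite map_cons, map_app. change (map fst [(a, t / 2)]) with [a].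
    rewrite app_comm_cons. apply last_last.
Qed.

Lemma peq_rotn {A} j (c : list (A * R)) : valid_cyc c -> peq c (rotn j c).
Proof.
  revert c. induction j as [|j IH]; intros c H; [apply peq_refl|].
  apply peq_trans with (rot1 c).
  - assert (N := valid_cyc_nonneg c H). assert (T := valid_cyc_total c H).
    destruct c as [|p c]; [apply peq_refl|].
    apply peq_sym, (peq_app_comm [p] c); [|now inversion N|exact T].
    constructor; [now inversion N|constructor].
  - rewrite rotn_S. apply IH. now apply (valid_cyc_rotn 1).
Qed.

Lemma peq_ends {A} (a : A) t t' s :
  0 < t -> 0 < t' -> nonneg_times s -> peq ((a, t) :: s ++ [(a, t')]) ((a, t + t') :: s).
Proof.
  intros Ht Ht' Hs. assert (H0 := total_nonneg s Hs).
  rewrite Rplus_comm. apply peq_trans with ((a, t') :: (a, t) :: s).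
  - apply (peq_app_comm [(a, t')] ((a, t) :: s)).
    + constructor; [simpl; lra|constructor].
    + constructor; [simpl; lra|exact Hs].
    + simpl. rewrite !total_cons. lra.
  - now apply peq_merge.
Qed.

Lemma peq_unroll {A} (c : list (A * R)) : valid_cyc c -> peq (unroll c) c.
Proof.
  intros H. assert (N := valid_cyc_nonneg c H). destruct H as [H1 [H2 H3]].
  destruct c as [|[a t] [|p c]]; [congruence|apply peq_refl|].
  inversion H2; subst. inversion N; subst. simpl in *.
  unfold unroll. replace t with (t / 2 + t / 2) at 3 by field.
  apply (peq_ends a (t / 2) (t / 2) (p :: c)); auto; lra.
Qed.

Lemma valid_seq_cyc {A} (s : list (A * R)) :
  valid_seq s -> exists c, valid_cyc c /\ peq s c.
Proof.
  destruct s as [|[a t] s]; [intros []|]. intros [H1 [H2 H3]].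
  destruct s as [|p s].
  { exists [(a, t)]. split; [|apply peq_refl]. repeat split; auto. discriminate. }
  destruct (exists_last (l := p :: s) ltac:(discriminate)) as [m [[e t'] E]].
  rewrite E in *. clear E p s.
  rewrite map_cons, map_app in *. change (map fst [(e, t')]) with [e] in *.
  rewrite app_comm_cons, last_last in H3. simpl in H3. subst e.
  inversion H1 as [|? ? Ht Hm]; subst. apply Forall_app in Hm. destruct Hm as [Hm Ht'].
  apply Forall_inv in Ht'. simpl in Ht, Ht'.
  (* The last piece has the state of the first one, since l(T-) = l(0); the two are joined across
     the base point. *)
  exists ((a, t + t') :: m). split.
  - split; [discriminate|]. split; [constructor; [simpl; lra|exact Hm]|].
    destruct m as [|q m]; simpl; [exact I|]. simpl in H2. tauto.
  - apply peq_ends; auto. eapply Forall_impl; [|exact Hm]. simpl. intros; lra.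
Qed.

Definition mk_bl {A} (c : list (A * R)) (H : valid_cyc c) : BL A :=
  exist _ (unroll c) (unroll_valid c H).

Lemma loop_cyc_exists {A} (L : Loop A) :
  exists c, valid_cyc c /\ peq (proj1_sig (loop_rep L)) c.
Proof. apply valid_seq_cyc, proj2_sig. Qed.

(** The starting piece is an arbitrary choice, so what follows is phrased through all rotations of
    this list. *)
Definition loop_cyc {A} (L : Loop A) : list (A * R) :=
  proj1_sig (constructive_indefinite_description _ (loop_cyc_exists L)).

Lemma loop_cyc_valid {A} (L : Loop A) : valid_cyc (loop_cyc L).
Proof. unfold loop_cyc. destruct constructive_indefinite_description. simpl. tauto. Qed.

Lemma loop_cyc_peq {A} (L : Loop A) : peq (proj1_sig (loop_rep L)) (loop_cyc L).
Proof. unfold loop_cyc. destruct constructive_indefinite_description. simpl. tauto. Qed.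

Lemma loop_of_mk_bl {A} (L : Loop A) c (H : valid_cyc c) :
  peq (loop_cyc L) c -> loop_of (mk_bl c H) = L.
Proof.
  intros E. rewrite <- (loop_of_rep L). apply loop_of_eq. simpl.
  apply peq_trans with c; [now apply peq_unroll|].
  apply peq_trans with (loop_cyc L); apply peq_sym; [exact E|apply loop_cyc_peq].
Qed.

Lemma loop_occ_cyc {A} (x : list A) (L : Loop A) :
  loop_occ x L = cyc (wint (loop_cyc L)) x.
Proof.
  unfold loop_occ. rewrite occ_based_cyc.
  apply cyc_wint_peq; [apply bl_nonneg_times|apply valid_cyc_nonneg, loop_cyc_valid|
    apply bl_total_pos|apply loop_cyc_peq].
Qed.

(** * Occupation fields of words with as many blocks as the loop has jumps *)

(** The exponent n stands for n + 1 copies, so that no block is empty. *)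
Definition blocks {A} (B : list (A * nat)) : list A :=
  flat_map (fun p => repeat (fst p) (S (snd p))) B.

(** The contribution to Chen's series in which the i-th piece of the path fills exactly the i-th
    block. *)
Fixpoint block_weight {A} (c : list (A * R)) (B : list (A * nat)) : R :=
  match c, B with
  | nil, nil => 1
  | (a, t) :: c', (b, n) :: B' =>
      eqi a b * (t ^ S n / INR (fact (S n))) * block_weight c' B'
  | _, _ => 0
  end.

Lemma block_weight_length {A} (c : list (A * R)) (B : list (A * nat)) :
  length c <> length B -> block_weight c B = 0.
Proof.
  revert B. induction c as [|[a t] c IH]; intros [|[b n] B] H; cbn [block_weight]; auto; [easy|].
  rewrite IH; [ring|]. simpl in H. lia.
Qed.

Lemma block_weight_app {A} (c1 c2 : list (A * R)) (B1 B2 : list (A * nat)) :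
  length c1 = length B1 ->
  block_weight (c1 ++ c2) (B1 ++ B2) = block_weight c1 B1 * block_weight c2 B2.
Proof.
  revert B1. induction c1 as [|[a t] c1 IH]; intros [|[b n] B1] H; try discriminate.
  - simpl. ring.
  - cbn [block_weight app]. rewrite IH by (simpl in H; lia). ring.
Qed.

Lemma block_weight_rotn {A} j (c : list (A * R)) (B : list (A * nat)) :
  length c = length B -> block_weight (rotn j c) (rotn j B) = block_weight c B.
Proof.
  revert c B. induction j as [|j IH]; intros c B H; [reflexivity|].
  rewrite !rotn_S, IH.
  - destruct c as [|[a t] c], B as [|[b n] B]; try discriminate; [reflexivity|].
    simpl in H. unfold rot1. rewrite block_weight_app by lia. cbn [block_weight]. ring.
  - destruct c, B; try discriminate; [reflexivity|].
    simpl in *. rewrite !length_app. simpl. lia.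
Qed.

(** [g] vanishes on every suffix that still contains a letter of the first block, so only the cuts
    after the whole block remain. *)
Lemma conv_repeat {A} (f g : list A -> R) b n y :
  (forall m, g (repeat b (S m) ++ y) = 0) ->
  conv f g (repeat b n ++ y) = conv (fun z => f (repeat b n ++ z)) g y.
Proof.
  intros H. revert f. induction n as [|n IH]; intros f; [reflexivity|].
  change (repeat b (S n) ++ y) with (b :: (repeat b n ++ y)).
  change (conv f g (b :: (repeat b n ++ y))) with
    (f nil * g (repeat b (S n) ++ y) + conv (fun z => f (b :: z)) g (repeat b n ++ y)).
  rewrite H, IH. simpl. ring.
Qed.

Lemma eqi_idem {A} (a b : A) : eqi a b * eqi a b = eqi a b.
Proof. unfold eqi. destruct excluded_middle_informative; ring. Qed.

Lemma eqi_nonneg {A} (a b : A) : 0 <= eqi a b.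
Proof. unfold eqi. destruct excluded_middle_informative; lra. Qed.

Lemma const_word_repeat {A} (a b : A) n : const_word a (repeat b (S n)) = eqi a b.
Proof.
  induction n as [|n IH]; [simpl; ring|].
  change (const_word a (repeat b (S (S n)))) with (eqi a b * const_word a (repeat b (S n))).
  rewrite IH. apply eqi_idem.
Qed.

Lemma const_word_app {A} (a : A) y z : const_word a (y ++ z) = const_word a y * const_word a z.
Proof. induction y as [|b y IH]; simpl; [|rewrite IH]; ring. Qed.

(* Each letter of [c] can fill at most one block of the word. *)
Lemma wint_blocks {A} (c : list (A * R)) (B : list (A * nat)) :
  consec_distinct (map fst B) -> (length c <= length B)%nat ->
  wint c (blocks B) = block_weight c B.
Proof.
  revert B. induction c as [|[a t] c IH]; intros B HB HL.
  { destruct B as [|[b n] B]; reflexivity. }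
  destruct B as [|[b n] B]; simpl in HL; [lia|].
  change (blocks ((b, n) :: B)) with (repeat b (S n) ++ blocks B).
  change (wint ((a, t) :: c)) with (conv (expw a t) (wint c)).
  rewrite conv_repeat.
  (* A suffix that keeps part of the first block has more blocks than the remaining pieces can
     fill. *)
  2:{ intros m. change (repeat b (S m) ++ blocks B) with (blocks ((b, m) :: B)).
      rewrite IH; [|exact HB|simpl; lia]. apply block_weight_length. simpl. lia. }
  assert (HB' : consec_distinct (map fst B)).
  { destruct B as [|[b' n'] B]; simpl in *; tauto. }
  transitivity (expw a t (repeat b (S n)) * wint c (blocks B)).
  - destruct B as [|[b' n'] B].
    + simpl conv. rewrite app_nil_r. simpl. ring.
    + change (blocks ((b', n') :: B)) with (b' :: (repeat b' n' ++ blocks B)).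
      change (conv ?f ?g (?x :: ?y)) with (f nil * g (x :: y) + conv (fun z => f (x :: z)) g y).
      cbv beta. rewrite app_nil_r, conv_zero_l; [ring|]. intros z. unfold expw.
      rewrite const_word_app, const_word_repeat. cbn [const_word].
      (* The first piece cannot go beyond its block either, as the next block has another letter. *)
      assert (E : eqi a b * eqi a b' = 0).
      { unfold eqi. destruct excluded_middle_informative; [|ring].
        destruct excluded_middle_informative; [|ring].
        subst. simpl in HB. tauto. }
      replace (eqi a b * (eqi a b' * const_word a z)) with (eqi a b * eqi a b' * const_word a z) by ring.
      rewrite E. unfold Rdiv. ring.
  - rewrite IH by (auto; lia). unfold expw. rewrite const_word_repeat, repeat_length.
    cbn [block_weight]. reflexivity.
Qed.

Lemma length_blocks_cons {A} (b : A) n B :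
  length (blocks ((b, n) :: B)) = (S n + length (blocks B))%nat.
Proof. unfold blocks. cbn [flat_map]. rewrite length_app, repeat_length. reflexivity. Qed.

Lemma blocks_app {A} (B1 B2 : list (A * nat)) : blocks (B1 ++ B2) = blocks B1 ++ blocks B2.
Proof. apply flat_map_app. Qed.

(** Starting inside the first block splits it into a block at either end. The word then has one
    block more than the cyclic word, too many for the pieces of [c]. *)
Lemma wint_blocks_cut {A} (c : list (A * R)) b n (B : list (A * nat)) j :
  B <> nil -> cyc_distinct (map fst ((b, n) :: B)) -> (length c <= S (length B))%nat ->
  (1 <= j <= n)%nat -> wint c (rotn j (blocks ((b, n) :: B))) = 0.
Proof.
  intros HB HD HL Hj.
  change (blocks ((b, n) :: B)) with (repeat b (S n) ++ blocks B).
  replace (S n) with (j + S (n - j))%nat by lia. rewrite repeat_app, <- app_assoc.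
  rewrite <- (repeat_length b j) at 1. rewrite rotn_app, <- app_assoc.
  replace (repeat b j) with (blocks [(b, (j - 1)%nat)]).
  2:{ unfold blocks. cbn [flat_map fst snd]. rewrite app_nil_r. f_equal. lia. }
  rewrite <- blocks_app.
  change (repeat b (S (n - j)) ++ blocks ?C) with (blocks ((b, (n - j)%nat) :: C)).
  rewrite wint_blocks.
  - apply block_weight_length. simpl. rewrite length_app. simpl. lia.
  - destruct B as [|[b' n'] B]; [congruence|]. rewrite map_cons, map_app. exact HD.
  - simpl. rewrite length_app. simpl. lia.
Qed.

(** Rotations are grouped by the block in which they start, and only the start at the beginning of a
    block survives. The induction carries finished blocks over to the end of [B2], which makes the
    statement one about part of the rotations. *)
Lemma nsum_wint_blocks {A} (c : list (A * R)) (B1 B2 : list (A * nat)) :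
  (2 <= length (B1 ++ B2))%nat -> cyc_distinct (map fst (B1 ++ B2)) ->
  (length c <= length (B1 ++ B2))%nat ->
  nsum (fun j => wint c (rotn j (blocks (B1 ++ B2)))) (length (blocks B1)) =
  nsum (fun r => block_weight c (rotn r (B1 ++ B2))) (length B1).
Proof.
  revert B2. induction B1 as [|[b n] B1 IH]; intros B2 H2 HD HL; [reflexivity|].
  rewrite length_blocks_cons, nsum_add. simpl length at 2. rewrite (nsum_Sl _ (length B1)).
  simpl app in *. f_equal.
  - rewrite nsum_Sl, (nsum_ext _ (fun _ => 0)).
    + rewrite nsum_zero, Rplus_0_r. apply (wint_blocks c ((b, n) :: B1 ++ B2)); [|exact HL].
      now apply cyc_distinct_consec.
    + intros i Hi. apply wint_blocks_cut; auto; [|lia].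
      destruct (B1 ++ B2); [simpl in H2; lia|discriminate].
  - assert (E : rot1 ((b, n) :: B1 ++ B2) = B1 ++ (B2 ++ [(b, n)])).
    { simpl. now rewrite app_assoc. }
    assert (LE : length (B1 ++ B2 ++ [(b, n)]) = length ((b, n) :: B1 ++ B2)).
    { simpl. rewrite !length_app. simpl. lia. }
    rewrite (nsum_ext _ (fun r => wint c (rotn r (blocks (B1 ++ B2 ++ [(b, n)]))))).
    + rewrite IH; [|lia| |lia].
      * apply nsum_ext. intros r _. now rewrite rotn_S, E.
      * rewrite <- E. change (rot1 ?y) with (rotn 1 y). rewrite map_rotn.
        now apply cyc_distinct_rotn.
    + intros j _. rewrite Nat.add_comm, rotn_add. f_equal. f_equal.
      change (blocks ((b, n) :: B1 ++ B2)) with (repeat b (S n) ++ blocks (B1 ++ B2)).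
      rewrite <- (repeat_length b (S n)) at 1. rewrite rotn_app, !blocks_app, <- app_assoc.
      f_equal. f_equal. unfold blocks. cbn [flat_map fst snd]. now rewrite app_nil_r.
Qed.

(* A constant loop sees all rotations of a one-letter word, not just one per block. *)
Definition multiplicity {A} (B : list (A * nat)) : R :=
  match B with [(_, n)] => INR (S n) | _ => 1 end.

Lemma multiplicity_pos {A} (B : list (A * nat)) : 0 < multiplicity B.
Proof.
  destruct B as [|[b n] [|p B]]; unfold multiplicity; try lra. apply lt_0_INR. lia.
Qed.

Lemma cyc_wint_blocks {A} (c : list (A * R)) (B : list (A * nat)) :
  c <> nil -> cyc_distinct (map fst B) -> (length c <= length B)%nat ->
  cyc (wint c) (blocks B) =
  multiplicity B * nsum (fun r => block_weight c (rotn r B)) (length B).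
Proof.
  intros Hc HD HL. destruct B as [|[b n] [|p B]].
  - destruct c; [congruence|simpl in HL; lia].
  - unfold multiplicity, cyc. change (length [(b, n)]) with 1%nat.
    rewrite length_blocks_cons, Nat.add_0_r.
    rewrite (nsum_ext _ (fun _ => block_weight c [(b, n)])).
    + rewrite nsum_const. simpl nsum. change (rotn 0 ?y) with y. ring.
    + intros j Hj. rewrite <- wint_blocks by (simpl; auto; lia). f_equal.
      unfold blocks. cbn [flat_map fst snd]. rewrite app_nil_r.
      clear. revert j. assert (E : rot1 (repeat b (S n)) = repeat b (S n)).
      { simpl. now rewrite <- repeat_cons. }
      intros j. induction j as [|j IH]; [reflexivity|]. now rewrite rotn_S, E.
  - unfold multiplicity. rewrite Rmult_1_l. unfold cyc.
    assert (E := nsum_wint_blocks c ((b, n) :: p :: B) nil).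
    rewrite !app_nil_r in E. apply E; auto. simpl. lia.
Qed.

(** Exponents are shifted by one, in accordance with [blocks]. *)
Fixpoint pmono (t : list R) (n : list nat) : R :=
  match t, n with
  | u :: t', k :: n' => u ^ S k * pmono t' n'
  | _, _ => 1
  end.

Definition facts (n : list nat) : R := fold_right (fun k r => INR (fact (S k)) * r) 1 n.

Lemma eqi_cons {A} (a b : A) x y : eqi (a :: x) (b :: y) = eqi a b * eqi x y.
Proof.
  unfold eqi. repeat destruct excluded_middle_informative; try ring; exfalso; congruence.
Qed.

Lemma block_weight_combine {A} (c : list (A * R)) (v : list A) n :
  length n = length v -> length c = length v ->
  block_weight c (combine v n) * facts n = eqi (map fst c) v * pmono (map snd c) n.
Proof.
  revert v n. induction c as [|[a t] c IH]; intros [|b v] [|k n] H1 H2; try discriminate.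
  - simpl. rewrite eqi_refl. ring.
  - simpl in H1, H2. cbn [combine block_weight map fst snd pmono]. rewrite eqi_cons.
    change (facts (k :: n)) with (INR (fact (S k)) * facts n).
    transitivity (eqi a b * t ^ S k * (block_weight c (combine v n) * facts n)).
    + field. apply INR_fact_neq_0.
    + rewrite IH by lia. ring.
Qed.

(** Integral of [f] against the counting measure on those rotations whose states spell [v];
    rotations giving the same list are counted separately. *)
Definition orbit_sum {A} (v : list A) (f : list R -> R) (c : list (A * R)) : R :=
  nsum (fun r => eqi (map fst (rotn r c)) v * f (map snd (rotn r c))) (length c).

Lemma map_fst_combine {A B} (v : list A) (n : list B) :
  length n = length v -> map fst (combine v n) = v.
Proof.
  revert n. induction v as [|a v IH]; intros [|k n] H; try discriminate; [reflexivity|].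
  simpl in *. rewrite IH; auto.
Qed.

Lemma cyc_wint_orbit_sum {A} (c : list (A * R)) (v : list A) n :
  c <> nil -> cyc_distinct v -> length c = length v -> length n = length v ->
  cyc (wint c) (blocks (combine v n)) * (facts n / multiplicity (combine v n)) =
  orbit_sum v (fun t => pmono t n) c.
Proof.
  intros Hc HD HL Hn.
  assert (HB : length (combine v n) = length c) by (rewrite length_combine; lia).
  rewrite cyc_wint_blocks; [|auto|now rewrite map_fst_combine|lia].
  rewrite HB. unfold orbit_sum.
  assert (M := multiplicity_pos (combine v n)).
  match goal with |- ?m * ?s * (?f / ?m) = _ => transitivity (f * s); [field; lra|] end.
  rewrite <- nsum_scal.
  (* Rotating the word by r has the effect of rotating the loop by its number of pieces minus r. *)
  rewrite <- (nsum_periodic_rev (fun r => eqi (map fst (rotn r c)) v * _)) by now rewrite rotn_full.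
  apply nsum_ext. intros r Hr.
  rewrite <- block_weight_combine by (rewrite ?length_rotn; auto).
  rewrite <- (block_weight_rotn (length c - r) c (rotn r (combine v n)))
    by (rewrite length_rotn; auto).
  rewrite <- rotn_add. replace (length c - r + r)%nat with (length c) by lia.
  rewrite <- HB at 2. rewrite rotn_full. ring.
Qed.

(** A cyclically reduced word consists of one-letter blocks, and it has a vanishing field as soon as
    there are more of them than pieces. *)
Lemma cyc_wint_length {A} (c : list (A * R)) (x : list A) :
  c <> nil -> cyc_distinct x -> cyc (wint c) x <> 0 -> (length x <= length c)%nat.
Proof.
  intros Hc HD H. destruct (Nat.le_gt_cases (length x) (length c)) as [L|L]; [exact L|].
  exfalso. apply H. set (n := repeat 0%nat (length x)).
  assert (Hn : length n = length x) by apply repeat_length.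
  assert (E : blocks (combine x n) = x).
  { unfold n. clear. induction x as [|a x IH]; simpl in *; [reflexivity|]. now rewrite IH. }
  rewrite <- E, cyc_wint_blocks; auto.
  - rewrite (nsum_ext _ (fun _ => 0)); [rewrite nsum_zero; ring|].
    intros r _. apply block_weight_length. rewrite length_rotn, length_combine. lia.
  - now rewrite map_fst_combine.
  - rewrite length_combine. lia.
Qed.

(** * Generated sigma-fields and measurable functions *)

Lemma sigma_gen_ext {X} (G : (X -> Prop) -> Prop) (A B : X -> Prop) :
  (forall x, A x <-> B x) -> sigma_gen G A -> sigma_gen G B.
Proof.
  intros H HA. replace B with A; [exact HA|].
  apply functional_extensionality. intros x. now apply propositional_extensionality.
Qed.

Lemma sigma_gen_const {X} (G : (X -> Prop) -> Prop) (P : Prop) : sigma_gen G (fun _ => P).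
Proof.
  destruct (classic P) as [H|H].
  - apply (sigma_gen_ext G (fun _ => True)); [tauto|apply sg_full].
  - apply (sigma_gen_ext G (fun _ => ~ True)); [tauto|apply sg_compl, sg_full].
Qed.

Lemma sigma_gen_union {X I} (G : (X -> Prop) -> Prop) (A : I -> X -> Prop) :
  countable I -> (forall i, sigma_gen G (A i)) -> sigma_gen G (fun x => exists i, A i x).
Proof.
  intros [f Hf] H.
  apply (sigma_gen_ext G (fun x => exists n, exists i, f i = n /\ A i x)).
  { intros x; split; [intros [n [i [_ Hi]]]; eauto|intros [i Hi]; eauto]. }
  apply sg_union. intros n. destruct (classic (exists i, f i = n)) as [[i Hi]|Hn].
  - apply (sigma_gen_ext G (A i)); [|apply H]. intros x. split; [eauto|].
    intros [j [Hj Hx]]. replace i with j; [exact Hx|]. apply Hf. congruence.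
  - apply (sigma_gen_ext G (fun _ => False)); [|apply sigma_gen_const].
    intros x. split; [tauto|]. intros [i [Hi _]]. apply Hn. eauto.
Qed.

Lemma countable_nat : countable nat.
Proof. now exists (fun n => n). Qed.

(** Induction on the length of the lists replaces an encoding of lists by natural numbers. *)
Lemma sigma_gen_union_list {X I} (G : (X -> Prop) -> Prop) (A : list I -> X -> Prop) :
  countable I -> (forall l, sigma_gen G (A l)) -> sigma_gen G (fun x => exists l, A l x).
Proof.
  intros HI H.
  apply (sigma_gen_ext G (fun x => exists n, exists l, length l = n /\ A l x)).
  { intros x; split; [intros [n [l [_ Hl]]]; eauto|intros [l Hl]; eauto]. }
  apply sg_union. intros n. revert A H. induction n as [|n IH]; intros A H.
  - apply (sigma_gen_ext G (A nil)); [|apply H]. intros x. split; [now exists nil|].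
    intros [[|i l] [E Hl]]; [exact Hl|discriminate].
  - apply (sigma_gen_ext G (fun x => exists i, exists l, length l = n /\ A (i :: l) x)).
    2:{ apply sigma_gen_union; [exact HI|]. intros i. apply IH. intros l. apply H. }
    intros x. split.
    + intros [i [l [E Hl]]]. exists (i :: l). simpl. auto.
    + intros [[|i l] [E Hl]]; [discriminate|]. injection E as E. eauto.
Qed.

Lemma sigma_gen_or {X} (G : (X -> Prop) -> Prop) (A B : X -> Prop) :
  sigma_gen G A -> sigma_gen G B -> sigma_gen G (fun x => A x \/ B x).
Proof.
  intros HA HB. apply (sigma_gen_ext G (fun x => exists n : nat, (if n then A else B) x)).
  - intros x. split; [intros [[|n] Hn]; auto|].
    intros [Ha|Hb]; [now exists 0%nat|now exists 1%nat].
  - apply sg_union. intros [|n]; auto.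
Qed.

Lemma sigma_gen_and {X} (G : (X -> Prop) -> Prop) (A B : X -> Prop) :
  sigma_gen G A -> sigma_gen G B -> sigma_gen G (fun x => A x /\ B x).
Proof.
  intros HA HB. apply (sigma_gen_ext G (fun x => ~ (~ A x \/ ~ B x))).
  - intros x. split; [|tauto]. intros H. split; apply NNPP; tauto.
  - apply sg_compl, sigma_gen_or; now apply sg_compl.
Qed.

(** The sets that do not separate two given points form a sigma-field. *)
Lemma sigma_gen_indistinguishable {X} (G : (X -> Prop) -> Prop) (x y : X) A :
  (forall B, G B -> (B x <-> B y)) -> sigma_gen G A -> (A x <-> A y).
Proof.
  intros H. induction 1 as [B HB| |B _ IH|B _ IH]; [auto|tauto|tauto|].
  split; intros [n Hn]; exists n; apply IH; exact Hn.
Qed.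

Definition meas {X} (G : (X -> Prop) -> Prop) (F : X -> R) : Prop :=
  forall a, sigma_gen G (fun x => a < F x).

Lemma inv_INR_pos n : 0 < / INR (S n).
Proof. apply Rinv_0_lt_compat, lt_0_INR. lia. Qed.

Lemma inv_INR_small eps : 0 < eps -> exists n, / INR (S n) < eps.
Proof.
  intros H. destruct (archimed_cor1 eps H) as [[|n] [H1 H2]]; [lia|eauto].
Qed.

(** Rationals are given by three naturals so that unions over them are directly instances of
    [sg_union]. *)
Lemma rational_dense x y :
  x < y -> exists m n k, x < (INR m - INR n) / INR (S k) < y.
Proof.
  intros H. destruct (inv_INR_small (y - x)) as [k Hk]; [lra|].
  assert (Hp : 0 < INR (S k)) by (apply lt_0_INR; lia).
  destruct (archimed (x * INR (S k))) as [H1 H2]. set (z := up (x * INR (S k))) in *.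
  exists (Z.to_nat z), (Z.to_nat (- z)), k.
  replace (INR (Z.to_nat z) - INR (Z.to_nat (- z))) with (IZR z).
  2:{ rewrite !INR_IZR_INZ, <- minus_IZR. f_equal. lia. }
  split.
  - apply Rmult_lt_reg_r with (INR (S k)); [exact Hp|]. unfold Rdiv.
    rewrite Rmult_assoc, Rinv_l by lra. lra.
  - apply Rle_lt_trans with (x + / INR (S k)); [|lra].
    apply Rmult_le_reg_r with (INR (S k)); [exact Hp|]. unfold Rdiv.
    rewrite Rmult_assoc, Rmult_plus_distr_r, Rinv_l by lra. lra.
Qed.

Lemma meas_plus {X} (G : (X -> Prop) -> Prop) F H :
  meas G F -> meas G H -> meas G (fun x => F x + H x).
Proof.
  intros HF HH a. set (q m n k := (INR m - INR n) / INR (S k)).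
  apply (sigma_gen_ext G (fun x => exists m n k, q m n k < F x /\ a - q m n k < H x)).
  - intros x. split; [intros [m [n [k [H1 H2]]]]; lra|]. intros Hx.
    destruct (rational_dense (a - H x) (F x)) as [m [n [k Hq]]]; [lra|].
    exists m, n, k. unfold q. lra.
  - do 3 (apply sg_union; intros ?). apply sigma_gen_and; auto.
Qed.

Lemma meas_opp {X} (G : (X -> Prop) -> Prop) F : meas G F -> meas G (fun x => - F x).
Proof.
  intros HF a. apply (sigma_gen_ext G (fun x => exists n, ~ (- a - / INR (S n) < F x))).
  - intros x. split.
    + intros [n Hn]. assert (P := inv_INR_pos n). lra.
    + intros H. destruct (inv_INR_small (- a - F x)) as [n Hn]; [lra|]. exists n. lra.
  - apply sg_union. intros n. apply sg_compl, HF.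
Qed.

Lemma meas_scal {X} (G : (X -> Prop) -> Prop) k F : meas G F -> meas G (fun x => k * F x).
Proof.
  assert (P : forall k F, 0 < k -> meas G F -> meas G (fun x => k * F x)).
  { clear. intros k F Hk HF a. apply (sigma_gen_ext G (fun x => a / k < F x)); [|apply HF].
    intros x. rewrite (Rmult_comm k). now rewrite <- Rlt_div_l. }
  intros HF. destruct (Rtotal_order k 0) as [H|[->|H]].
  - intros a. apply (sigma_gen_ext G (fun x => a < - ((- k) * F x))).
    + intros x. replace (- (- k * F x)) with (k * F x) by ring. tauto.
    + apply meas_opp, P; [lra|exact HF].
  - intros a. apply (sigma_gen_ext G (fun _ => a < 0)); [|apply sigma_gen_const].
    intros x. rewrite Rmult_0_l. tauto.
  - now apply P.
Qed.

Lemma sigma_gen_lt {X} (G : (X -> Prop) -> Prop) F H :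
  meas G F -> meas G H -> sigma_gen G (fun x => F x < H x).
Proof.
  intros HF HH. apply (sigma_gen_ext G (fun x => 0 < H x + - F x)); [intros; lra|].
  apply (meas_plus G H); [exact HH|now apply meas_opp].
Qed.

Lemma open_ray a : open_R (fun y => a < y).
Proof.
  intros x Hx. exists (x - a). split; [lra|]. intros y Hy. apply Rabs_lt_between in Hy. lra.
Qed.

Lemma meas_loop_occ {St} (x : list St) :
  (1 <= length x)%nat -> meas occ_generators (loop_occ x).
Proof.
  intros Hx a. apply sg_base. exists x. split; [exact Hx|].
  exists (fun y => a < y). split; [apply sg_base, open_ray|reflexivity].
Qed.

(** * The number of jumps and the symmetrized holding times are measurable *)

Fixpoint incr (i : nat) (n : list nat) : list nat :=
  match n, i with
  | nil, _ => nil
  | k :: n', O => S k :: n'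
  | k :: n', S i' => k :: incr i' n'
  end.

Lemma length_incr i n : length (incr i n) = length n.
Proof. revert i. induction n as [|k n IH]; intros [|i]; simpl; auto. Qed.

Lemma pmono_incr t n i :
  length t = length n -> (i < length n)%nat -> pmono t (incr i n) = nth i t 0 * pmono t n.
Proof.
  revert t i. induction n as [|k n IH]; intros [|u t] [|i] Ht Hi; simpl in Ht, Hi; try lia.
  - cbn [incr pmono nth]. rewrite <- (tech_pow_Rmult u (S k)). ring.
  - cbn [incr pmono nth]. rewrite IH by lia. ring.
Qed.

Lemma pmono_pos t n : Forall (fun u => 0 < u) t -> 0 < pmono t n.
Proof.
  intros H. revert n. induction H as [|u t Hu _ IH]; intros [|k n]; cbn [pmono]; try lra.
  apply Rmult_lt_0_compat; [now apply pow_lt|apply IH].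
Qed.

Fixpoint sqdist (t q : list R) : R :=
  match t, q with
  | u :: t', w :: q' => (u - w) ^ 2 + sqdist t' q'
  | _, _ => 0
  end.

Lemma orbit_sum_ext {A} (v : list A) f g c :
  length c = length v -> (forall t, length t = length v -> f t = g t) ->
  orbit_sum v f c = orbit_sum v g c.
Proof.
  intros Hc H. apply nsum_ext. intros r _. rewrite H; [reflexivity|].
  now rewrite length_map, length_rotn.
Qed.

Lemma orbit_sum_plus {A} (v : list A) f g c :
  orbit_sum v (fun t => f t + g t) c = orbit_sum v f c + orbit_sum v g c.
Proof. unfold orbit_sum. rewrite <- nsum_plus. apply nsum_ext. intros; ring. Qed.

Lemma orbit_sum_scal {A} (v : list A) k f c :
  orbit_sum v (fun t => k * f t) c = k * orbit_sum v f c.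
Proof. unfold orbit_sum. rewrite <- nsum_scal. apply nsum_ext. intros; ring. Qed.

(* On the loops with [length v] jumps the orbit sum of every multiple of [P] by a monomial
   is a combination of occupation fields. *)
Definition orbit_meas {St} (v : list St) (P : list R -> R) : Prop :=
  forall n, length n = length v -> exists F, meas occ_generators F /\
    forall L, length (loop_cyc L) = length v ->
      F L = orbit_sum v (fun t => pmono t n * P t) (loop_cyc L).

Lemma orbit_meas_ext {St} (v : list St) P P' :
  (forall t, length t = length v -> P t = P' t) -> orbit_meas v P -> orbit_meas v P'.
Proof.
  intros H HP n Hn. destruct (HP n Hn) as [F [HF E]]. exists F. split; [exact HF|].
  intros L HL. rewrite E by exact HL. apply orbit_sum_ext; [exact HL|].
  intros t Ht. now rewrite H.
Qed.

Lemma orbit_meas_plus {St} (v : list St) P P' :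
  orbit_meas v P -> orbit_meas v P' -> orbit_meas v (fun t => P t + P' t).
Proof.
  intros HP HP' n Hn. destruct (HP n Hn) as [F [HF E]]. destruct (HP' n Hn) as [F' [HF' E']].
  exists (fun L => F L + F' L). split; [now apply meas_plus|].
  intros L HL. rewrite E, E', <- orbit_sum_plus by exact HL.
  apply orbit_sum_ext; [exact HL|]. intros; ring.
Qed.

Lemma orbit_meas_scal {St} (v : list St) k P :
  orbit_meas v P -> orbit_meas v (fun t => k * P t).
Proof.
  intros HP n Hn. destruct (HP n Hn) as [F [HF E]].
  exists (fun L => k * F L). split; [now apply meas_scal|].
  intros L HL. rewrite E, <- orbit_sum_scal by exact HL.
  apply orbit_sum_ext; [exact HL|]. intros; ring.
Qed.

(** A coordinate is absorbed into the monomial; this is why [orbit_meas] asks for all exponents at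
    once. *)
Lemma orbit_meas_coord {St} (v : list St) i P :
  (i < length v)%nat -> orbit_meas v P -> orbit_meas v (fun t => nth i t 0 * P t).
Proof.
  intros Hi HP n Hn. destruct (HP (incr i n)) as [F [HF E]]; [now rewrite length_incr|].
  exists F. split; [exact HF|]. intros L HL. rewrite E by exact HL.
  apply orbit_sum_ext; [exact HL|]. intros t Ht.
  rewrite pmono_incr by lia. ring.
Qed.

Lemma loop_cyc_neq_nil {St} (L : Loop St) : loop_cyc L <> nil.
Proof. apply loop_cyc_valid. Qed.

(** The place where occupation fields enter: all other orbit sums are built from these by linear
    combinations and multiplication by coordinates. *)
Lemma orbit_meas_one {St} (v : list St) :
  v <> nil -> cyc_distinct v -> orbit_meas v (fun _ => 1).
Proof.
  intros Hv HD n Hn. set (B := combine v n).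
  exists (fun L => facts n / multiplicity B * loop_occ (blocks B) L). split.
  - apply meas_scal, meas_loop_occ. unfold B.
    destruct v as [|a v], n as [|k n]; try discriminate; [congruence|].
    unfold blocks. simpl. lia.
  - intros L HL. rewrite loop_occ_cyc, Rmult_comm. unfold B.
    rewrite cyc_wint_orbit_sum by (auto using loop_cyc_neq_nil).
    apply orbit_sum_ext; [exact HL|]. intros; ring.
Qed.

Lemma skipn_nth_cons {A} (d : A) i t :
  (i < length t)%nat -> skipn i t = nth i t d :: skipn (S i) t.
Proof.
  revert t. induction i as [|i IH]; intros [|u t] H; simpl in H; try lia; [reflexivity|].
  simpl. rewrite IH by lia. reflexivity.
Qed.

Lemma orbit_meas_sqdist {St} (v : list St) q P :
  length q = length v -> orbit_meas v P -> orbit_meas v (fun t => sqdist t q * P t).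
Proof.
  intros Hq HP.
  (* The coordinates of [t] must keep their absolute positions for [orbit_meas_coord], so the
     induction on [q] looks at a tail of a fixed [t]. *)
  enough (H : forall q i, (i + length q = length v)%nat ->
    orbit_meas v (fun t => sqdist (skipn i t) q * P t)) by now apply (H q O).
  clear q Hq. intros q. induction q as [|w q IH]; intros i Hi.
  - apply (orbit_meas_ext v (fun t => 0 * P t)); [|now apply orbit_meas_scal].
    intros t _. now destruct (skipn i t).
  - simpl in Hi. specialize (IH (S i) ltac:(lia)).
    assert (H1 := orbit_meas_coord v i P ltac:(lia) HP).
    assert (H2 := orbit_meas_coord v i _ ltac:(lia) H1).
    eapply orbit_meas_ext;
      [|exact (orbit_meas_plus _ _ _ (orbit_meas_plus _ _ _ H2
          (orbit_meas_plus _ _ _ (orbit_meas_scal v (- 2 * w) _ H1) (orbit_meas_scal v (w ^ 2) _ HP))) IH)].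
    intros t Ht. rewrite (skipn_nth_cons 0 i t) by lia.
    change (sqdist (?a :: ?x) (?b :: ?y)) with ((a - b) ^ 2 + sqdist x y). cbv beta. ring.
Qed.

Lemma orbit_meas_pow {St} (v : list St) q k N :
  v <> nil -> cyc_distinct v -> length q = length v ->
  orbit_meas v (fun t => (k - sqdist t q) ^ N).
Proof.
  intros Hv HD Hq. induction N as [|N IH]; [now apply orbit_meas_one|].
  eapply orbit_meas_ext;
    [|exact (orbit_meas_plus _ _ _ (orbit_meas_scal v k _ IH)
        (orbit_meas_scal v (-1) _ (orbit_meas_sqdist v q _ Hq IH)))].
  intros t _. simpl. ring.
Qed.

(** Up to a factor the field is an orbit sum of nonnegative terms, and the trivial rotation
    contributes a positive one. *)
Lemma loop_occ_self {St} (L : Loop St) :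
  loop_occ (map fst (loop_cyc L)) L <> 0.
Proof.
  assert (V := loop_cyc_valid L). rewrite loop_occ_cyc. set (c := loop_cyc L) in *.
  destruct V as [Hc [Hp HD]]. set (v := map fst c) in *.
  assert (Lv : length c = length v) by (symmetry; apply length_map).
  set (n := repeat 0%nat (length v)).
  assert (Hn : length n = length v) by apply repeat_length.
  assert (E : blocks (combine v n) = v).
  { unfold n. clear. induction v as [|a x IH]; simpl in *; [reflexivity|]. now rewrite IH. }
  intros H0. assert (S0 := cyc_wint_orbit_sum c v n Hc HD Lv Hn).
  rewrite E, H0, Rmult_0_l in S0.
  assert (Pos : forall r, 0 <= eqi (map fst (rotn r c)) v * pmono (map snd (rotn r c)) n).
  { intros r. apply Rmult_le_pos; [apply eqi_nonneg|]. apply Rlt_le, pmono_pos, Forall_map.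
    now apply Forall_rotn. }
  assert (T := nsum_term_le _ (length c) O Pos).
  fold (orbit_sum v (fun t => pmono t n) c) in T. rewrite <- S0 in T.
  change (rotn 0 c) with c in T. fold v in T. rewrite eqi_refl, Rmult_1_l in T.
  assert (0 < pmono (map snd c) n) by now apply pmono_pos, Forall_map.
  assert (0 < length c)%nat by (destruct c; [congruence|simpl; lia]).
  specialize (T H1). lra.
Qed.

Lemma sigma_gen_loop_cyc_length {St} (HS : countable St) p :
  sigma_gen occ_generators (fun L : Loop St => length (loop_cyc L) = p).
Proof.
  assert (H : forall p, sigma_gen occ_generators (fun L : Loop St => (p <= length (loop_cyc L))%nat)).
  { clear p. intros p.
    (* Cyclically reduced words with nonzero field are no longer than the loop, by
       [cyc_wint_length], and [loop_occ_self] shows that the bound is attained. *)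
    apply (sigma_gen_ext _ (fun L : Loop St => exists x : list St,
      ((1 <= length x)%nat /\ cyc_distinct x /\ (p <= length x)%nat) /\ loop_occ x L <> 0)).
    - intros L. split.
      + intros [x [[_ [H1 H2]] H3]]. rewrite loop_occ_cyc in H3.
        apply cyc_wint_length in H3; [lia|apply loop_cyc_neq_nil|exact H1].
      + intros H. exists (map fst (loop_cyc L)). rewrite length_map.
        destruct (loop_cyc_valid L) as [Hc [_ HD]].
        split; [split; [|split]|apply loop_occ_self]; auto.
        destruct (loop_cyc L); [congruence|simpl; lia].
    - apply sigma_gen_union_list; [exact HS|]. intros x.
      destruct (classic ((1 <= length x)%nat /\ cyc_distinct x /\ (p <= length x)%nat)) as [Hx|Hx].
      + apply sigma_gen_and; [apply sigma_gen_const|].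
        assert (M := meas_loop_occ x (proj1 Hx)).
        apply (sigma_gen_ext _ (fun L => 0 < loop_occ x L \/ 0 < - loop_occ x L)).
        * intros L. lra.
        * apply sigma_gen_or; [apply M|now apply (meas_opp _ _ M)].
      + apply (sigma_gen_ext _ (fun _ => False)); [tauto|apply sigma_gen_const]. }
  apply (sigma_gen_ext _ (fun L => (p <= length (loop_cyc L))%nat /\ ~ (S p <= length (loop_cyc L))%nat)).
  - intros L. lia.
  - apply sigma_gen_and; [apply H|apply sg_compl, H].
Qed.

(** * A countable measurable base *)

Definition sqnorm (t : list R) : R := fold_right (fun u r => u ^ 2 + r) 0 t.

Lemma sqnorm_rotn j t : sqnorm (rotn j t) = sqnorm t.
Proof.
  revert t. induction j as [|j IH]; intros t; [reflexivity|]. rewrite rotn_S, IH.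
  destruct t as [|u t]; [reflexivity|]. simpl rot1.
  induction t as [|w t IHt]; [reflexivity|].
  unfold sqnorm in *. simpl in *. lra.
Qed.

Lemma sqnorm_nonneg t : 0 <= sqnorm t.
Proof.
  induction t as [|u t IH]; unfold sqnorm in *; cbn [fold_right]; [lra|].
  assert (0 <= u ^ 2) by apply pow2_ge_0. lra.
Qed.

Lemma sqdist_zeros t : sqdist t (repeat 0 (length t)) = sqnorm t.
Proof.
  induction t as [|u t IH]; [reflexivity|].
  change (sqdist (u :: t) _) with ((u - 0) ^ 2 + sqdist t (repeat 0 (length t))).
  rewrite IH, Rminus_0_r. reflexivity.
Qed.

Lemma sqdist_nonneg t q : 0 <= sqdist t q.
Proof.
  revert q. induction t as [|u t IH]; intros [|w q]; cbn [sqdist]; try lra.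
  assert (0 <= (u - w) ^ 2) by apply pow2_ge_0. specialize (IH q). lra.
Qed.

(** Termwise (u - w)^2 <= (u - w)^2 + (u + w)^2 = 2 u^2 + 2 w^2. This is the source of 4 K. *)
Lemma sqdist_le t q : sqdist t q <= 2 * sqnorm t + 2 * sqnorm q.
Proof.
  revert q. induction t as [|u t IH]; intros [|w q];
    try (assert (H := sqnorm_nonneg (u :: t))); try (assert (H' := sqnorm_nonneg (w :: q)));
    cbn [sqdist]; try (change (sqnorm nil) with 0; lra).
  change (sqnorm (u :: t)) with (u ^ 2 + sqnorm t).
  change (sqnorm (w :: q)) with (w ^ 2 + sqnorm q).
  specialize (IH q). assert (0 <= (u + w) ^ 2) by apply pow2_ge_0. nra.
Qed.

Lemma sqdist_nth t q i :
  length t = length q -> (nth i t 0 - nth i q 0) ^ 2 <= sqdist t q.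
Proof.
  revert q i. induction t as [|u t IH]; intros [|w q] i H; try discriminate.
  - destruct i; simpl; lra.
  - cbn [sqdist]. simpl in H.
    destruct i as [|i]; cbn [nth].
    + assert (S0 := sqdist_nonneg t q). lra.
    + specialize (IH q i ltac:(lia)). assert (0 <= (u - w) ^ 2) by apply pow2_ge_0. lra.
Qed.

(** Rational centers with a common denominator; nonnegative ones suffice because holding times are
    positive. *)
Definition grid (k : nat) (ms : list nat) : list R := map (fun m => INR m / INR (S k)) ms.

Lemma grid_dense t eps :
  Forall (fun u => 0 < u) t -> 0 < eps ->
  exists k ms, length ms = length t /\ sqdist t (grid k ms) < eps.
Proof.
  intros Ht Heps.
  assert (HL := pos_INR (length t)).
  destruct (inv_INR_small (eps / (INR (length t) + 1))) as [k Hk].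
  { apply Rdiv_lt_0_compat; lra. }
  exists k. assert (P := inv_INR_pos k). set (h := / INR (S k)) in *.
  assert (Hp : 1 <= INR (S k)) by (rewrite S_INR; assert (Q := pos_INR k); lra).
  assert (Hh : h <= 1) by (unfold h; rewrite <- Rinv_1; apply Rinv_le_contravar; lra).
  (* Rounding down to multiples of h makes an error below h in each coordinate, and h^2 <= h since h
     <= 1. *)
  enough (H : exists ms, length ms = length t /\ sqdist t (grid k ms) <= INR (length t) * h).
  { destruct H as [ms [H1 H2]]. exists ms. split; [exact H1|].
    assert (h * (INR (length t) + 1) < eps) by (apply Rlt_div_r; [lra|exact Hk]). lra. }
  clear Hk HL. induction Ht as [|u t Hu _ IH].
  - exists nil. split; [reflexivity|simpl; lra].
  - destruct IH as [ms [H1 H2]].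
    destruct (nfloor_ex (u * INR (S k))) as [m Hm]; [apply Rmult_le_pos; lra|].
    exists (m :: ms). split; [simpl; lia|].
    change (sqdist (u :: t) (grid k (m :: ms))) with
      ((u - INR m / INR (S k)) ^ 2 + sqdist t (grid k ms)).
    change (length (u :: t)) with (S (length t)). rewrite (S_INR (length t)).
    assert (E : u - INR m / INR (S k) = (u * INR (S k) - INR m) * h).
    { unfold h. field. lra. }
    rewrite E. set (r := u * INR (S k) - INR m) in *.
    assert (0 <= r < 1) by (unfold r; lra).
    assert (Hr : 0 <= r * h <= h) by (split; [apply Rmult_le_pos; lra|nra]).
    assert ((r * h) ^ 2 <= h) by nra.
    lra.
Qed.

Section Base.

Context {St : Type}.
Implicit Types (v : list St) (L : Loop St).

(** The product of the holding times, the lowest monomial that the fields provide. *)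
Definition weight v (t : list R) : R := pmono t (repeat 0%nat (length v)).

(* [K] bounds the squared length of the holding times, so that [4 K - |t - q|^2] is nonnegative
   on the whole orbit; its high powers then detect whether the orbit comes [eps]-close to [q]. *)
Definition base_set v (q : list R) (K eps : R) L : Prop :=
  length (loop_cyc L) = length v /\
  orbit_sum v (fun t => weight v t * sqnorm t) (loop_cyc L) <=
    K * orbit_sum v (weight v) (loop_cyc L) /\
  exists N, (4 * K - eps) ^ N * orbit_sum v (weight v) (loop_cyc L) <
    orbit_sum v (fun t => weight v t * (4 * K - sqdist t q) ^ N) (loop_cyc L).

Lemma sigma_gen_base_set v q K eps :
  countable St -> v <> nil -> cyc_distinct v -> length q = length v ->
  sigma_gen occ_generators (base_set v q K eps).
Proof.
  intros HS Hv HD Hq. set (n0 := repeat 0%nat (length v)).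
  assert (Hn0 : length n0 = length v) by apply repeat_length.
  assert (Hz : length (repeat 0 (length v)) = length v) by apply repeat_length.
  destruct (orbit_meas_one v Hv HD n0 Hn0) as [F1 [M1 E1]].
  destruct (orbit_meas_sqdist v _ _ Hz (orbit_meas_one v Hv HD) n0 Hn0) as [F2 [M2 E2]].
  (* The length condition is repeated for each N, since [F1] and [F3] are known to be orbit sums
     only on loops with that many pieces. *)
  assert (HN : forall N, sigma_gen occ_generators (fun L =>
    length (loop_cyc L) = length v /\
    (4 * K - eps) ^ N * orbit_sum v (weight v) (loop_cyc L) <
    orbit_sum v (fun t => weight v t * (4 * K - sqdist t q) ^ N) (loop_cyc L))).
  { intros N. destruct (orbit_meas_pow v q (4 * K) N Hv HD Hq n0 Hn0) as [F3 [M3 E3]].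
    apply (sigma_gen_ext _ (fun L => length (loop_cyc L) = length v /\
      (4 * K - eps) ^ N * F1 L < F3 L)).
    - intros L. split; intros [HL H]; (split; [exact HL|]);
        rewrite E1, E3 in * by exact HL;
        rewrite (orbit_sum_ext v (fun t => pmono t n0 * 1) (weight v)) in *
          by (auto; intros; unfold weight; fold n0; ring); exact H.
    - apply sigma_gen_and; [now apply sigma_gen_loop_cyc_length|].
      apply sigma_gen_lt; [now apply meas_scal|exact M3]. }
  apply (sigma_gen_ext _ (fun L =>
    (length (loop_cyc L) = length v /\ ~ (K * F1 L < F2 L)) /\
    exists N, length (loop_cyc L) = length v /\
      (4 * K - eps) ^ N * orbit_sum v (weight v) (loop_cyc L) <
      orbit_sum v (fun t => weight v t * (4 * K - sqdist t q) ^ N) (loop_cyc L))).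
  - intros L. unfold base_set.
    enough (E : length (loop_cyc L) = length v ->
      F1 L = orbit_sum v (weight v) (loop_cyc L) /\
      F2 L = orbit_sum v (fun t => weight v t * sqnorm t) (loop_cyc L)).
    { split.
      - intros [[HL HK] [N [_ HN']]]. destruct (E HL) as [<- <-].
        split; [exact HL|]. split; [lra|]. exists N.
        destruct (E HL) as [-> _]. exact HN'.
      - intros [HL [HK [N HN']]]. destruct (E HL) as [-> ->].
        split; [split; [exact HL|lra]|]. eauto. }
    intros HL. rewrite E1, E2 by exact HL. split; apply orbit_sum_ext; auto.
    + intros; unfold weight; fold n0; ring.
    + intros t Ht. unfold weight. fold n0. rewrite <- sqdist_zeros, Ht. ring.
  - apply sigma_gen_and.
    + apply sigma_gen_and; [now apply sigma_gen_loop_cyc_length|].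
      apply sg_compl, sigma_gen_lt; [now apply meas_scal|exact M2].
    + apply sg_union. exact HN.
Qed.

Lemma loop_cyc_times_pos L r : Forall (fun u => 0 < u) (map snd (rotn r (loop_cyc L))).
Proof. apply Forall_map, Forall_rotn. apply loop_cyc_valid. Qed.

(** If every rotation spelling [v] stayed at squared distance at least [eps], each term of the orbit
    sum would be at most (4 K - eps)^N times its weight, against the last condition of
    [base_set]. *)
Lemma base_set_near v q K eps L :
  base_set v q K eps L -> sqnorm q <= K -> eps <= 4 * K ->
  exists r, (r < length (loop_cyc L))%nat /\ map fst (rotn r (loop_cyc L)) = v /\
    sqdist (map snd (rotn r (loop_cyc L))) q < eps.
Proof.
  intros [HL [HK [N HN]]] Hq Heps. apply NNPP. intros Hno.
  set (c := loop_cyc L) in *.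
  assert (Hfar : forall r, (r < length c)%nat -> map fst (rotn r c) = v ->
    eps <= sqdist (map snd (rotn r c)) q).
  { intros r Hr Hv. apply Rnot_lt_le. intros Hlt. apply Hno. eauto. }
  clear Hno. apply Rlt_not_le in HN. apply HN. clear HN.
  (* The squared norm is constant on the orbit and factors out, so the second condition bounds it by
     K once some rotation spells [v]. *)
  assert (E : orbit_sum v (fun t => weight v t * sqnorm t) c =
    sqnorm (map snd c) * orbit_sum v (weight v) c).
  { rewrite <- orbit_sum_scal. apply nsum_ext. intros r _.
    rewrite (map_rotn snd), sqnorm_rotn. ring. }
  rewrite E in HK.
  assert (W : forall r, 0 < weight v (map snd (rotn r c))).
  { intros r. apply pmono_pos, loop_cyc_times_pos. }
  assert (Hin : forall r, (r < length c)%nat -> map fst (rotn r c) = v ->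
    0 <= 4 * K - sqdist (map snd (rotn r c)) q).
  { intros r Hr Hv. assert (B := sqdist_le (map snd (rotn r c)) q).
    rewrite (map_rotn snd), sqnorm_rotn, <- (map_rotn snd) in B.
    enough (sqnorm (map snd c) <= K) by lra.
    assert (T := nsum_term_le (fun r => eqi (map fst (rotn r c)) v * weight v (map snd (rotn r c)))
      (length c) r).
    fold (orbit_sum v (weight v) c) in T. cbv beta in T. rewrite Hv, eqi_refl, Rmult_1_l in T.
    assert (T' : weight v (map snd (rotn r c)) <= orbit_sum v (weight v) c).
    { apply T; [|exact Hr]. intros j. apply Rmult_le_pos; [apply eqi_nonneg|apply Rlt_le, W]. }
    specialize (W r). apply Rmult_le_reg_r with (orbit_sum v (weight v) c); lra. }
  rewrite <- orbit_sum_scal. apply nsum_le. intros r Hr.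
  destruct (classic (map fst (rotn r c) = v)) as [Hv|Hv].
  - apply Rmult_le_compat_l; [apply eqi_nonneg|]. rewrite Rmult_comm.
    apply Rmult_le_compat_r; [apply Rlt_le, W|]. apply pow_incr.
    specialize (Hfar r Hr Hv). specialize (Hin r Hr Hv). lra.
  - rewrite eqi_neq by exact Hv. lra.
Qed.

(** The term of the trivial rotation grows like b^N with b > a and alone overtakes a^N times the
    total weight; the other terms are nonnegative thanks to 4 K. *)
Lemma base_set_self v q K eps L :
  map fst (loop_cyc L) = v -> sqdist (map snd (loop_cyc L)) q < eps ->
  sqnorm (map snd (loop_cyc L)) <= K -> sqnorm q <= K -> eps < 4 * K ->
  base_set v q K eps L.
Proof.
  intros Hv Hd Ht Hq Heps. set (c := loop_cyc L) in *.
  assert (HL : length c = length v) by (rewrite <- Hv; symmetry; apply length_map).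
  assert (W : forall r, 0 < weight v (map snd (rotn r c))).
  { intros r. apply pmono_pos, loop_cyc_times_pos. }
  split; [exact HL|]. fold c. split.
  - rewrite <- orbit_sum_scal. apply nsum_le. intros r _.
    apply Rmult_le_compat_l; [apply eqi_nonneg|].
    rewrite map_rotn, sqnorm_rotn, Rmult_comm, <- map_rotn.
    apply Rmult_le_compat_r; [apply Rlt_le, W|exact Ht].
  - set (a := 4 * K - eps). set (b := 4 * K - sqdist (map snd c) q).
    assert (Ha : 0 < a) by (unfold a; lra). assert (Hab : a < b) by (unfold a, b; lra).
    set (O1 := orbit_sum v (weight v) c). set (w := weight v (map snd c)).
    assert (Hw : 0 < w) by apply (W O).
    (* N is large enough for w b^N to exceed O1 a^N; adding 1 makes the inequality strict. *)
    destruct (Pow_x_infinity (b / a)) with (b := (O1 / w + 1)%R) as [N HN].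
    { rewrite Rabs_right; [|apply Rle_ge, Rlt_le, Rdiv_lt_0_compat; lra].
      apply Rlt_gt. apply Rlt_div_r; lra. }
    exists N. specialize (HN N (le_n N)). apply Rge_le in HN.
    rewrite Rabs_right in HN by (apply Rle_ge, pow_le, Rlt_le, Rdiv_lt_0_compat; lra).
    assert (HaN : 0 < a ^ N) by now apply pow_lt.
    apply Rlt_le_trans with (w * b ^ N).
    + assert (E : b ^ N = (b / a) ^ N * a ^ N).
      { rewrite <- Rpow_mult_distr. f_equal. field. lra. }
      rewrite E. assert (O1 = O1 / w * w) by (field; lra).
      set (x := (b / a) ^ N) in *. set (y := O1 / w) in *. rewrite H.
      replace (a ^ N * (y * w)) with (a ^ N * w * y) by ring.
      replace (w * (x * a ^ N)) with (a ^ N * w * x) by ring.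
      apply Rmult_lt_compat_l; [now apply Rmult_lt_0_compat|lra].
    + assert (T := nsum_term_le (fun r => eqi (map fst (rotn r c)) v *
        (weight v (map snd (rotn r c)) * (4 * K - sqdist (map snd (rotn r c)) q) ^ N))
        (length c) O).
      cbv beta in T. change (rotn 0 c) with c in T. rewrite Hv, eqi_refl, Rmult_1_l in T.
      apply T.
      * intros j. apply Rmult_le_pos; [apply eqi_nonneg|].
        apply Rmult_le_pos; [apply Rlt_le, W|]. apply pow_le.
        assert (B := sqdist_le (map snd (rotn j c)) q).
        rewrite (map_rotn snd), sqnorm_rotn, <- (map_rotn snd) in B. lra.
      * assert (c <> nil) by apply loop_cyc_neq_nil. destruct c; [congruence|simpl; lia].
Qed.

End Base.

(** With [rep_states], the two columns of [unroll]; they are separated because the topology fixes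
    the states and perturbs only the times. *)
Definition rep_times (t : list R) : list R :=
  match t with
  | u :: ((_ :: _) as r) => u / 2 :: r ++ [u / 2]
  | _ => t
  end.

Definition rep_states {A} (w : list A) : list A :=
  match w with
  | a :: ((_ :: _) as r) => a :: r ++ [a]
  | _ => w
  end.

Lemma map_snd_unroll {A} (c : list (A * R)) : map snd (unroll c) = rep_times (map snd c).
Proof.
  destruct c as [|[a t] [|p c]]; try reflexivity. unfold unroll.
  rewrite map_cons, map_app. reflexivity.
Qed.

Lemma map_fst_unroll {A} (c : list (A * R)) : map fst (unroll c) = rep_states (map fst c).
Proof.
  destruct c as [|[a t] [|p c]]; try reflexivity. unfold unroll.
  rewrite map_cons, map_app. reflexivity.
Qed.

Lemma rep_times_close t t' eps i :
  length t' = length t -> 0 < eps ->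
  (forall j, Rabs (nth j t' 0 - nth j t 0) < eps) ->
  Rabs (nth i (rep_times t') 0 - nth i (rep_times t) 0) < eps.
Proof.
  intros HL He H.
  assert (Z : Rabs (0 - 0) < eps) by (rewrite Rminus_0_r, Rabs_R0; exact He).
  destruct t as [|u [|w t]], t' as [|u' [|w' t']]; try discriminate; [exact (H i)..|].
  assert (Hh : Rabs (u' / 2 - u / 2) < eps).
  { specialize (H O). simpl in H. apply Rabs_lt_between in H. apply Rabs_lt_between. lra. }
  unfold rep_times. destruct i as [|i]; [exact Hh|].
  cbn [nth]. simpl in HL.
  destruct (Nat.lt_ge_cases i (length (w :: t))) as [Hi|Hi].
  - rewrite !app_nth1 by (simpl in *; lia). apply (H (S i)).
  - rewrite !app_nth2 by (simpl in *; lia).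
    replace (length (w' :: t')) with (length (w :: t)) by (simpl; lia).
    destruct (i - length (w :: t))%nat as [|[|k]]; simpl nth; auto.
Qed.

Lemma Rabs_lt_of_sq x y : 0 < y -> x ^ 2 < y ^ 2 -> Rabs x < y.
Proof.
  intros Hy H. apply Rabs_lt_between. split; nra.
Qed.

(** Every parameter is a natural number or a list over a countable type, ready for countable
    unions. *)
Definition base_index {St} (v : list St) (k : nat) (ms : list nat) (K n : nat) : Loop St -> Prop :=
  base_set v (grid k ms) (INR (S K)) (/ INR (S n)).

Definition index_ok {St} (v : list St) (k : nat) (ms : list nat) (K : nat) : Prop :=
  v <> nil /\ cyc_distinct v /\ length ms = length v /\ sqnorm (grid k ms) <= INR (S K).

Lemma inv_INR_le_1 n : / INR (S n) <= 1.
Proof.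
  rewrite <- Rinv_1. apply Rinv_le_contravar; [lra|]. rewrite S_INR.
  assert (H := pos_INR n). lra.
Qed.

Lemma base_index_bound n K : / INR (S n) < 4 * INR (S K).
Proof.
  assert (H := inv_INR_le_1 n). rewrite (S_INR K). assert (H' := pos_INR K). lra.
Qed.

Lemma base_index_exists {St} (L : Loop St) eps :
  0 < eps -> exists v k ms K n, index_ok v k ms K /\ base_index v k ms K n L /\
  forall L', base_index v k ms K n L' ->
    exists r, (r < length (loop_cyc L'))%nat /\
      map fst (rotn r (loop_cyc L')) = map fst (loop_cyc L) /\
      forall i, Rabs (nth i (map snd (rotn r (loop_cyc L'))) 0 -
                      nth i (map snd (loop_cyc L)) 0) < eps.
Proof.
  intros Heps. set (c := loop_cyc L). set (v := map fst c). set (t := map snd c).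
  destruct (loop_cyc_valid L) as [Hc [Hp HD]]. fold c in Hc, Hp, HD.
  (* Radii bound squared distances: both loops come within [eps / 2] of the center in every
     coordinate, hence within [eps] of each other. *)
  destruct (inv_INR_small ((eps / 2) ^ 2)) as [n Hn]; [apply pow_lt; lra|].
  destruct (grid_dense t (/ INR (S n))) as [k [ms [Hms Hd]]];
    [now apply Forall_map|apply inv_INR_pos|].
  set (q := grid k ms) in *.
  destruct (nfloor_ex (sqnorm t + sqnorm q)) as [K HK].
  { assert (H1 := sqnorm_nonneg t). assert (H2 := sqnorm_nonneg q). lra. }
  rewrite <- S_INR in HK.
  assert (H1 := sqnorm_nonneg t). assert (H2 := sqnorm_nonneg q).
  assert (Hlt : length t = length v) by (unfold t, v; now rewrite !length_map).
  assert (Hlq : length q = length v) by (unfold q, grid; rewrite length_map; lia).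
  exists v, k, ms, K, n. split; [|split].
  - split; [|split; [exact HD|split; [lia|fold q; lra]]].
    intros E. apply Hc. apply map_eq_nil in E. exact E.
  - apply base_set_self; fold c; fold t; fold q; auto using base_index_bound; lra.
  - intros L' HL'. destruct (base_set_near _ _ _ _ _ HL') as [r [Hr [Hv' Hd']]].
    + fold q. lra.
    + apply Rlt_le, base_index_bound.
    + exists r. split; [exact Hr|]. split; [exact Hv'|]. intros i.
      set (t' := map snd (rotn r (loop_cyc L'))) in *.
      assert (Hlt' : length t' = length v) by (rewrite <- Hv'; unfold t'; now rewrite !length_map).
      assert (A1 := sqdist_nth t q i ltac:(lia)). assert (A2 := sqdist_nth t' q i ltac:(lia)).
      assert (B1 : Rabs (nth i t 0 - nth i q 0) < eps / 2) by (apply Rabs_lt_of_sq; lra).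
      assert (B2 : Rabs (nth i t' 0 - nth i q 0) < eps / 2).
      { apply Rabs_lt_of_sq; [lra|]. fold q in Hd'. lra. }
      apply Rabs_lt_between in B1, B2. apply Rabs_lt_between. lra.
Qed.

(** * Open sets of loops and separation of loops *)

Lemma sigma_gen_open_Loop {St} (HS : countable St) (V : Loop St -> Prop) :
  open_Loop V -> sigma_gen occ_generators V.
Proof.
  intros HV.
  apply (sigma_gen_ext _ (fun L => exists v k ms K n,
    (index_ok v k ms K /\ forall L', base_index v k ms K n L' -> V L') /\
    base_index v k ms K n L)).
  - intros L. split; [intros [v [k [ms [K [n [[_ H] HL]]]]]]; auto|]. intros HL.
    (* Openness of [V] is a statement about based loops, so it is applied at the unrolled
       representative of [L]; below, [L'] is unrolled from the rotation that is close to it. *)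
    assert (HV0 : V (loop_of (mk_bl _ (loop_cyc_valid L)))).
    { rewrite (loop_of_mk_bl L) by apply peq_refl. exact HL. }
    destruct (HV _ HV0) as [eps [Heps Hnear]].
    destruct (base_index_exists L eps Heps) as [v [k [ms [K [n [Hok [Hself Hb]]]]]]].
    exists v, k, ms, K, n. split; [split; [exact Hok|]|exact Hself].
    intros L' HL'. destruct (Hb L' HL') as [r [_ [Hfst Hsnd]]].
    set (c' := rotn r (loop_cyc L')) in *.
    assert (Hc' : valid_cyc c') by apply valid_cyc_rotn, loop_cyc_valid.
    rewrite <- (loop_of_mk_bl L' c' Hc') by apply peq_rotn, loop_cyc_valid.
    apply Hnear.
    + unfold bl_states, mk_bl. simpl. now rewrite !map_fst_unroll, Hfst.
    + intros i _. unfold bl_times, mk_bl. simpl. rewrite !map_snd_unroll.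
      apply rep_times_close; auto.
      apply (f_equal (@length _)) in Hfst. rewrite !length_map in *. exact Hfst.
  - apply sigma_gen_union_list; [exact HS|]. intros v.
    apply sigma_gen_union; [apply countable_nat|]. intros k.
    apply sigma_gen_union_list; [apply countable_nat|]. intros ms.
    do 2 (apply sigma_gen_union; [apply countable_nat|]; intros ?).
    (* Whether the base set lies in [V] does not depend on the loop, so this factor is a constant
       event. *)
    match goal with |- sigma_gen _ (fun L => ?P /\ _) => destruct (classic P) as [HP|HP] end.
    + apply sigma_gen_and; [apply sigma_gen_const|].
      destruct HP as [[H1 [H2 [H3 _]]] _]. apply sigma_gen_base_set; auto.
      unfold grid. now rewrite length_map.
    + eapply sigma_gen_ext; [|apply (sigma_gen_const _ False)]. tauto.
Qed.

(** Pigeonhole over finitely many r: if the last one fails at e0, it fails below e0 as well, and the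
    smaller indices must serve all e. *)
Lemma exists_uniform (P : nat -> R -> Prop) p :
  (forall r e e', e <= e' -> P r e -> P r e') ->
  (forall e, 0 < e -> exists r, (r < p)%nat /\ P r e) ->
  exists r, (r < p)%nat /\ forall e, 0 < e -> P r e.
Proof.
  intros Hm. induction p as [|p IH]; intros H.
  - destruct (H 1) as [r [Hr _]]; [lra|lia].
  - destruct (classic (forall e, 0 < e -> P p e)) as [Hp|Hp]; [exists p; auto|].
    apply not_all_ex_not in Hp. destruct Hp as [e0 He0]. apply imply_to_and in He0.
    destruct He0 as [He0 Hn]. destruct IH as [r [Hr HP]]; [|exists r; split; [lia|exact HP]].
    intros e He. destruct (H (Rmin e e0)) as [r [Hr HP]]; [now apply Rmin_glb_lt|].
    exists r. split; [|apply Hm with (2 := HP), Rmin_l].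
    destruct (Nat.eq_dec r p) as [->|]; [|lia]. exfalso. apply Hn.
    apply Hm with (2 := HP), Rmin_r.
Qed.

Lemma loop_eq_of_cyc {St} (L L' : Loop St) r :
  rotn r (loop_cyc L') = loop_cyc L -> L = L'.
Proof.
  intros E. assert (V := loop_cyc_valid L).
  rewrite <- (loop_of_mk_bl L _ V) by apply peq_refl.
  apply loop_of_mk_bl. rewrite <- E. apply peq_rotn, loop_cyc_valid.
Qed.

Lemma list_eq_of_map {A} (c c' : list (A * R)) :
  map fst c = map fst c' -> map snd c = map snd c' -> c = c'.
Proof.
  revert c'. induction c as [|[a t] c IH]; intros [|[a' t'] c'] H1 H2; try discriminate; auto.
  simpl in *. injection H1 as -> H1. injection H2 as -> H2. f_equal. auto.
Qed.

(** Base sets around [L] contain [L'], so for each e some rotation of [L'] is e-close to [L]. There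
    are finitely many rotations, hence one works for all e and equals the list of [L] exactly. *)
Lemma loop_eq_of_base {St} (HS : countable St) (L L' : Loop St) :
  (forall A, sigma_gen occ_generators A -> (A L <-> A L')) -> L = L'.
Proof.
  intros H.
  destruct (exists_uniform (fun r e => map fst (rotn r (loop_cyc L')) = map fst (loop_cyc L) /\
      forall i, Rabs (nth i (map snd (rotn r (loop_cyc L'))) 0 -
                      nth i (map snd (loop_cyc L)) 0) < e) (length (loop_cyc L')))
    as [r [_ Hr]].
  - intros r e e' He [H1 H2]. split; [exact H1|]. intros i. specialize (H2 i). lra.
  - intros e He.
    destruct (base_index_exists L e He) as [v [k [ms [K [n [[H1 [H2 [H3 _]]] [Hself Hb]]]]]]].
    destruct (Hb L') as [r [Hr [H4 H5]]]; [|exists r; auto].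
    apply H in Hself; [exact Hself|]. apply sigma_gen_base_set; auto.
    unfold grid. now rewrite length_map.
  - apply (loop_eq_of_cyc L L' r). destruct (Hr 1 ltac:(lra)) as [Hfst _].
    apply list_eq_of_map; [exact Hfst|].
    apply nth_ext with 0 0.
    + apply (f_equal (@length _)) in Hfst. rewrite !length_map in *. exact Hfst.
    + intros i _. apply cond_eq. intros e He. apply (Hr e He).
Qed.

(** * Continuity of the occupation fields *)

(** The neighbourhood filter of [b] for [open_BL], introduced so that limits along filters are
    available. *)
Definition bl_near {St} (b : BL St) (P : BL St -> Prop) : Prop :=
  exists eps, 0 < eps /\ forall b' : BL St, bl_states b' = bl_states b ->
    (forall i, (i < length (bl_times b))%nat ->
       Rabs (nth i (bl_times b') 0 - nth i (bl_times b) 0) < eps) -> P b'.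

#[local] Instance bl_near_filter {St} (b : BL St) : Filter (bl_near b).
Proof.
  constructor.
  - exists 1. split; [lra|auto].
  - intros P Q [e1 [He1 H1]] [e2 [He2 H2]]. exists (Rmin e1 e2).
    split; [now apply Rmin_glb_lt|]. intros b' Hs Ht.
    split; [apply H1|apply H2]; auto; intros i Hi;
      (eapply Rlt_le_trans; [now apply Ht|]); [apply Rmin_l|apply Rmin_r].
  - intros P Q HPQ [e [He H]]. exists e. auto.
Qed.

Section Limits.

Context {T A : Type} (F : (T -> Prop) -> Prop) {FF : Filter F}.

Lemma filterlim_Rplus (f g : T -> R) x y :
  filterlim f F (locally x) -> filterlim g F (locally y) ->
  filterlim (fun b => f b + g b) F (locally (x + y)).
Proof. intros. eapply filterlim_comp_2; eauto. apply @filterlim_plus. Qed.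

Lemma filterlim_Rmult (f g : T -> R) x y :
  filterlim f F (locally x) -> filterlim g F (locally y) ->
  filterlim (fun b => f b * g b) F (locally (x * y)).
Proof. intros. eapply filterlim_comp_2; eauto. apply @filterlim_mult. Qed.

Lemma filterlim_pow (f : T -> R) x n :
  filterlim f F (locally x) -> filterlim (fun b => f b ^ n) F (locally (x ^ n)).
Proof.
  intros H. induction n as [|n IH]; simpl; [apply filterlim_const|].
  now apply filterlim_Rmult.
Qed.

Lemma filterlim_nsum (f : T -> nat -> R) x n :
  (forall i, filterlim (fun b => f b i) F (locally (x i))) ->
  filterlim (fun b => nsum (f b) n) F (locally (nsum x n)).
Proof.
  intros H. induction n as [|n IH]; simpl; [apply filterlim_const|].
  now apply filterlim_Rplus.
Qed.

Lemma filterlim_conv (f g : T -> list A -> R) f0 g0 x :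
  (forall y, filterlim (fun b => f b y) F (locally (f0 y))) ->
  (forall y, filterlim (fun b => g b y) F (locally (g0 y))) ->
  filterlim (fun b => conv (f b) (g b) x) F (locally (conv f0 g0 x)).
Proof.
  intros Hf Hg. revert f f0 Hf. induction x as [|a x IH]; intros f f0 Hf; simpl;
    (apply filterlim_Rplus; [now apply filterlim_Rmult|]); [apply filterlim_const|].
  apply (IH (fun b z => f b (a :: z))). intros y. apply Hf.
Qed.

Lemma filterlim_wint (ws : list A) (taus : list (T -> R)) ls x :
  Forall2 (fun tau l => filterlim tau F (locally l)) taus ls ->
  filterlim (fun b => wint (combine ws (map (fun tau => tau b) taus)) x) F
    (locally (wint (combine ws ls) x)).
Proof.
  intros H. revert ws x. induction H as [|tau l taus ls Hl _ IH]; intros [|w ws] x; simpl;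
    try apply filterlim_const.
  apply (filterlim_conv (fun b => expw w (tau b))
    (fun b => wint (combine ws (map (fun tau => tau b) taus)))); [|intros y; apply IH].
  intros y. unfold expw, Rdiv.
  apply filterlim_Rmult; [apply filterlim_const|].
  apply filterlim_Rmult; [now apply filterlim_pow|apply filterlim_const].
Qed.

End Limits.

Lemma combine_map_fst_snd {A B} (s : list (A * B)) : combine (map fst s) (map snd s) = s.
Proof. induction s as [|[a b] s IH]; simpl; [|rewrite IH]; reflexivity. Qed.

Lemma map_nth_seq (t : list R) : map (fun i => nth i t 0) (seq 0 (length t)) = t.
Proof.
  induction t as [|u t IH]; [reflexivity|]. simpl length. rewrite <- cons_seq, <- seq_shift.
  simpl. rewrite map_map. now rewrite IH.
Qed.

(** Near [b] the states are fixed and the field is a polynomial in the holding times. The chosen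
    representative [loop_rep] need not depend continuously on the loop; [loop_occ_loop_of] replaces
    it by the based loop itself. *)
Lemma loop_occ_continuous {St} (x : list St) (b : BL St) :
  filterlim (fun b' => loop_occ x (loop_of b')) (bl_near b) (locally (loop_occ x (loop_of b))).
Proof.
  set (ws := bl_states b). set (p := length (bl_times b)).
  set (taus := map (fun i (b' : BL St) => nth i (bl_times b') 0) (seq 0 p)).
  apply (filterlim_ext_loc (fun b' => cyc (wint (combine ws (map (fun tau => tau b') taus))) x)).
  (* The radius is arbitrary: only equality of the states is used. *)
  - exists 1. split; [lra|]. intros b' Hs _. rewrite loop_occ_loop_of. f_equal. f_equal.
    unfold taus. rewrite map_map.
    replace p with (length (bl_times b')).
    + rewrite map_nth_seq. unfold ws. rewrite <- Hs. apply combine_map_fst_snd.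
    + apply (f_equal (@length _)) in Hs. unfold p, bl_times, bl_states in *.
      rewrite !length_map in *. exact Hs.
  - rewrite loop_occ_loop_of, <- (combine_map_fst_snd (proj1_sig b)).
    apply (filterlim_nsum (bl_near b) (fun b' j =>
      wint (combine ws (map (fun tau => tau b') taus)) (rotn j x))).
    intros j. apply filterlim_wint; [typeclasses eauto|].
    unfold taus. fold (bl_times b).
    assert (E := map_nth_seq (bl_times b)). fold p in E.
    rewrite <- E. clear E.
    assert (Hin : forall i, In i (seq 0 p) -> (i < p)%nat) by (intros i; rewrite in_seq; lia).
    induction (seq 0 p) as [|i l IHl]; [constructor|].
    constructor; [|apply IHl; intros; apply Hin; now right].
    intros P [e He]. exists e. split; [apply cond_pos|]. intros b' _ H. apply He.
    apply (H i). apply Hin. now left.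
Qed.

(** * Equality of the two sigma-fields *)

Lemma Borel_Loop_occ_generators {St} (A : Loop St -> Prop) :
  occ_generators A -> Borel_Loop A.
Proof.
  intros [x [_ [B [HB ->]]]]. induction HB as [B HB| |B _ IH|B _ IH].
  - apply sg_base. intros b Hb. destruct (HB _ Hb) as [e [He H]].
    apply (loop_occ_continuous x b). now exists (mkposreal e He).
  - apply sg_full.
  - now apply sg_compl.
  - now apply sg_union.
Qed.

Lemma sigma_gen_mono {X} (G H : (X -> Prop) -> Prop) A :
  (forall B, G B -> sigma_gen H B) -> sigma_gen G A -> sigma_gen H A.
Proof.
  intros HG. induction 1; [auto|apply sg_full|now apply sg_compl|now apply sg_union].
Qed.

Theorem mainTheorem6 (St : Type) (HS : countable St) :
  (forall A : Loop St -> Prop, sigma_gen occ_generators A <-> Borel_Loop A) /\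
  (forall L L' : Loop St,
     (forall x : list St, (1 <= length x)%nat -> loop_occ x L = loop_occ x L') ->
     L = L').
Proof.
  split.
  - intros A. split; apply sigma_gen_mono.
    + apply Borel_Loop_occ_generators.
    + intros B. now apply sigma_gen_open_Loop.
  - intros L L' H. apply loop_eq_of_base; [exact HS|]. intros A.
    apply sigma_gen_indistinguishable. intros B [x [Hx [C [_ ->]]]].
    now rewrite (H x Hx).
Qed.
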